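(* Let $D\subset\mathbb R^2$ be a bounded domain such that for every continuous $g:\partial D\to\mathbb R$ there is $u_g\in C^2(D)\cap C(\overline D)$ with $\Delta u_g=0$ on $D$ and $u_g=g$ on $\partial D$, and for $x\in D$ let $I_x(g):=u_g(x)$ on $C(\partial D)$. Let $\mathcal L_x$ and $\int_x$ be the class of integrable functions and Daniell integral on $\partial D$ obtained from the $I$-integral $I_x$. If $f\in\mathcal L_x$ for some $x\in D$, then $f\in\mathcal L_y$ for every $y\in D$, and the function $v_f:D\to\mathbb R$, $v_f(y):=\int_y f$, is harmonic on $D$.
   Context: $\Delta u=\partial_1^2u+\partial_2^2u$; a function is harmonic on an open set if it is $C^2$ there with $\Delta u=0$. A domain is a connected open set. $\overline{\mathbb R}=\mathbb R\cup\{\pm\infty\}$. For each $x\in D$, $I_x$ is an $I$-integral on $C(\partial D)$ (linear, positive, and $I_x(g_n)\to0$ whenever $g_n\searrow0$ pointwise). The Daniell extension: $T_1$ is the set of functions $\partial D\to\overline{\mathbb R}$ that are pointwise limits of pointwise nondecreasing sequences $(g_n)\subset C(\partial D)$; $I_{1,x}(\varphi):=\lim_n I_x(g_n)\in\mathbb R\cup\{\infty\}$ for such a sequence (independent of choice); $\overline I_x(f):=\inf\{I_{1,x}(\varphi):\varphi\in T_1,\ \varphi\ge f\}$ (with $\inf\emptyset=+\infty$), $\underline I_x(f):=-\overline I_x(-f)$; $\mathcal L_x:=\{f:\partial D\to\overline{\mathbb R}\,:\ \overline I_x(f)=\underline I_x(f)\in\mathbb R\}$ and $\int_x f$ is the common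 value. *)

(* Defs.v *)
From HB Require Import structures.
From mathcomp Require Import all_boot all_order all_algebra.
From mathcomp Require Import all_classical all_reals all_analysis.
Set Implicit Arguments. Unset Strict Implicit. Unset Printing Implicit Defensive.
Import Order.TTheory GRing.Theory Num.Theory.
Import numFieldTopology.Exports numFieldNormedType.Exports.
Local Open Scope classical_set_scope.
Local Open Scope ring_scope.

Section PilotDefs.
Context {R : realType}.
Local Notation P := (R * R)%type.

(* boundary of an open set D : closure D minus D (= closure minus interior) *)
Definition bdry (D : set P) : set P := closure D `\` D.

Definition partial1 (u : P -> R) (x : P) : R := derive1 (fun t => u (t, x.2)) x.1.
Definition partial2 (u : P -> R) (x : P) : R := derive1 (fun t => u (x.1, t)) x.2.
Definition has_partial1 (u : P -> R) (x : P) : Prop :=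
  derivable (fun t => u (t, x.2)) x.1 1.
Definition has_partial2 (u : P -> R) (x : P) : Prop :=
  derivable (fun t => u (x.1, t)) x.2 1.

Definition C1_on (D : set P) (u : P -> R) : Prop :=
  {in D, continuous u} /\
  (forall x, D x -> has_partial1 u x /\ has_partial2 u x) /\
  {in D, continuous (partial1 u)} /\ {in D, continuous (partial2 u)}.

Definition C2_on (D : set P) (u : P -> R) : Prop :=
  C1_on D u /\ C1_on D (partial1 u) /\ C1_on D (partial2 u).

Definition laplacian (u : P -> R) (x : P) : R :=
  partial1 (partial1 u) x + partial2 (partial2 u) x.

Definition harmonic_on (D : set P) (u : P -> R) : Prop :=
  C2_on D u /\ forall x, D x -> laplacian u x = 0.

(* g : boundary D -> R continuous (only values on the boundary matter) *)
Definition Cbd (D : set P) (g : P -> R) : Prop := {within bdry D, continuous g}.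

Definition dirichlet_sol (D : set P) (g : P -> R) (u : P -> R) : Prop :=
  harmonic_on D u /\ {within closure D, continuous u} /\
  forall y, bdry D y -> u y = g y.

Definition incr_seq (D : set P) (g : nat -> P -> R) : Prop :=
  (forall n, Cbd D (g n)) /\ forall n y, bdry D y -> g n y <= g n.+1 y.

(* Daniell upper integral: inf of I_1(phi) = lim I(g_n) over phi in T_1, phi >= f
   (phi = pointwise limit of the nondecreasing sequence (g_n) in C(boundary D)) *)
Definition upper_int (D : set P) (I : (P -> R) -> R) (f : P -> \bar R) : \bar R :=
  ereal_inf [set l | exists (g : nat -> P -> R) (phi : P -> \bar R),
    [/\ incr_seq D g,
        (forall y, bdry D y -> (fun n => (g n y)%:E) @ \oo --> phi y),
        (forall y, bdry D y -> (f y <= phi y)%E) &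
        l = limn (fun n => (I (g n))%:E)]].

Definition lower_int (D : set P) (I : (P -> R) -> R) (f : P -> \bar R) : \bar R :=
  (- upper_int D I (fun y => - f y))%E.

Definition integrable_D (D : set P) (I : (P -> R) -> R) (f : P -> \bar R) : Prop :=
  exists r : R, upper_int D I f = r%:E /\ lower_int D I f = r%:E.

(* the Daniell integral of f (meaningful when f is integrable) *)
Definition daniell (D : set P) (I : (P -> R) -> R) (f : P -> \bar R) : R :=
  fine (upper_int D I f).

End PilotDefs.

(* Main.v *)
(* Everything rests on the maximum principle; no integral representation is used.
   A comparison argument bounds the first differences of a harmonic function on a
   square by its supremum; applied to difference quotients it bounds second
   derivatives, so locally uniform limits of harmonic functions are harmonic.
   Maximizing [u] against a weight vanishing on the boundary of a square, and
   comparing with [1/|z - p|^2] around the maximum [p], gives Harnack's inequality,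
   which propagates over the connected set [D].

   If [f] is integrable at [x], choose [g_k] increasing to a majorant of [f] and
   [g'_k] increasing to a majorant of [-f] with [lim U g_k x + lim U g'_k x] small.
   Harnack makes [a = lim U g_k] and [a' = lim U g'_k] harmonic on [D]; Dini's
   theorem on the compact boundary gives [a + a' >= 0], and Harnack again makes
   [a + a'] small locally uniformly. Upper and lower integrals at [y] lie between
   [- a' y] and [a y], so they coincide and are a locally uniform limit of harmonic
   functions. *)

From Pilot Require Import Defs.
From HB Require Import structures.
From mathcomp Require Import all_boot all_order all_algebra.
From mathcomp Require Import all_classical all_reals all_analysis.
From mathcomp Require Import ring lra.
Import Order.TTheory GRing.Theory Num.Theory.
Import numFieldTopology.Exports numFieldNormedType.Exports.
Local Open Scope classical_set_scope.
Local Open Scope ring_scope.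

Set Implicit Arguments.
Unset Strict Implicit.
Unset Printing Implicit Defensive.

Ltac unabs := repeat match goal with
  | H : is_true (`|_| <= _) |- _ => move/ler_normlP: H => [? ?]
  | H : is_true (`|_| < _) |- _ => move/ltr_normlP: H => [? ?]
  | H : _ /\ _ |- _ => destruct H
  | H : is_true (_ && _) |- _ => move/andP: H => [? ?]
  end.
Ltac abslra := unabs;
  try (apply/ler_normlP; split); try (apply/ltr_normlP; split); lra.

(** * Squares as a base of neighbourhoods in the plane *)

Section PlanarSquares.
Context {R : realType}.
Local Notation P := (R * R)%type.

Definition sq (x : P) (r : R) : set P :=
  [set z | `|z.1 - x.1| < r /\ `|z.2 - x.2| < r].
Definition csq (x : P) (r : R) : set P :=
  [set z | `|z.1 - x.1| <= r /\ `|z.2 - x.2| <= r].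

Lemma nbhs_sqP (x : P) (A : set P) :
  nbhs x A <-> exists2 r, 0 < r & sq x r `<=` A.
Proof.
have E r : ball x r = sq x r.
  apply/seteqP; split=> z; rewrite /ball /= /prod_ball /= -!ball_normE /= /sq /=
    ![`|z.1 - _|]distrC ![`|z.2 - _|]distrC //.
split=> [/nbhs_ballP [r r0 h]|[r r0 h]]; first by exists r => //; rewrite -E.
by apply/nbhs_ballP; exists r => //; rewrite E.
Qed.

Lemma open_sqP (D : set P) : open D <->
  forall x, D x -> exists2 r, 0 < r & sq x r `<=` D.
Proof.
rewrite openE; split=> h x /h; first by move=> /nbhs_sqP.
by move=> h'; apply/nbhs_sqP.
Qed.

Lemma continuous_sqP (u : P -> R) (x : P) : {for x, continuous u} <->
  forall e, 0 < e -> exists2 r, 0 < r & forall z, sq x r z -> `|u z - u x| <= e.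
Proof.
split.
  move=> /cvgrPdist_le h e /h /nbhs_sqP [r r0 hr]; exists r => // z /hr /=.
  by rewrite distrC.
move=> h; apply/cvgrPdist_le => e /h [r r0 hr]; apply/nbhs_sqP; exists r => //.
by move=> z /hr /=; rewrite distrC.
Qed.

Lemma sq_center (x : P) r : 0 < r -> sq x r x.
Proof. by move=> r0; split; rewrite subrr normr0. Qed.

Lemma subsq (x y : P) r s : `|y.1 - x.1| <= r - s -> `|y.2 - x.2| <= r - s ->
  sq y s `<=` sq x r.
Proof. by move=> h1 h2 z [h3 h4]; split; abslra. Qed.

Lemma subcsq (x y : P) r s : `|y.1 - x.1| < r - s -> `|y.2 - x.2| < r - s ->
  csq y s `<=` sq x r.
Proof. by move=> h1 h2 z [h3 h4]; split; abslra. Qed.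

Lemma sq_csq (x : P) r : sq x r `<=` csq x r.
Proof. by move=> z [/ltW ? /ltW ?]. Qed.

Lemma compact_rect (a b c d : R) :
  compact [set z : P | (a <= z.1 <= b) /\ (c <= z.2 <= d)].
Proof.
have -> : [set z : P | (a <= z.1 <= b) /\ (c <= z.2 <= d)] =
   [set` `[a, b]] `*` [set` `[c, d]].
  by apply/seteqP; split=> z /=; rewrite !in_itv.
by apply: compact_setX; exact: segment_compact.
Qed.

Lemma compact_csq (x : P) r : compact (csq x r).
Proof.
have -> : csq x r = [set z : P | (x.1 - r <= z.1 <= x.1 + r) /\
   (x.2 - r <= z.2 <= x.2 + r)].
  by apply/seteqP; split=> z; rewrite /csq /= !ler_distl.
exact: compact_rect.
Qed.

Lemma open_sq (x : P) r : open (sq x r).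
Proof.
apply/open_sqP => z [h1 h2].
exists (Num.min (r - `|z.1 - x.1|) (r - `|z.2 - x.2|)).
  by rewrite lt_min !subr_gt0 h1 h2.
move=> y [/=]; rewrite !lt_min => /andP[h3 _] /andP[_ h4]; split.
- have := ler_distD z.1 y.1 x.1; lra.
- have := ler_distD z.2 y.2 x.2; lra.
Qed.

End PlanarSquares.

(** * The five-point Laplacian and the maximum principle *)

Section FivePoint.
Context {R : realType}.
Local Notation P := (R * R)%type.
Implicit Types (u v w : P -> R) (x : P).

Definition cross u x s : R :=
  u (x.1 + s, x.2) + u (x.1 - s, x.2) + u (x.1, x.2 + s) + u (x.1, x.2 - s)
  - 4 * u x.

(* The Laplacian as the limit of five-point second differences: unlike the [C^2]
   definition it passes to translates, reflections and differences at once, and it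
   is nonpositive at a local maximum. *)
Definition lapl u x (l : R) : Prop := forall e, 0 < e ->
  exists2 r, 0 < r & forall s, 0 < s -> s < r -> `|cross u x s - l * s ^+ 2| <= e * s ^+ 2.

Lemma laplD u v x l m : lapl u x l -> lapl v x m -> lapl (fun z => u z + v z) x (l + m).
Proof.
move=> hu hv e e0; have e2 : 0 < e / 2 by lra.
have [r r0 hr] := hu _ e2; have [r' r'0 hr'] := hv _ e2.
exists (Num.min r r'); first by rewrite lt_min r0.
move=> s s0; rewrite lt_min => /andP[s1 s2].
move: (hr _ s0 s1) (hr' _ s0 s2); rewrite /cross => h1 h2.
set q := s ^+ 2 in h1 h2 *; abslra.
Qed.

Lemma laplZ (c : R) u x l : lapl u x l -> lapl (fun z => c * u z) x (c * l).
Proof.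
move=> hu e e0; have c0 : 0 < `|c| + 1 by have := normr_ge0 c; lra.
have [r r0 hr] := hu (e / (`|c| + 1)) (divr_gt0 e0 c0).
exists r => // s s0 s1; move: (hr _ s0 s1); rewrite /cross /= => h.
have -> : c * u (x.1 + s, x.2) + c * u (x.1 - s, x.2) + c * u (x.1, x.2 + s) +
  c * u (x.1, x.2 - s) - 4 * (c * u x) - c * l * s ^+ 2 =
  c * (u (x.1 + s, x.2) + u (x.1 - s, x.2) + u (x.1, x.2 + s) + u (x.1, x.2 - s) -
     4 * u x - l * s ^+ 2) by ring.
rewrite normrM; apply: (le_trans (ler_wpM2l (normr_ge0 _) h)).
rewrite mulrA; apply: ler_wpM2r; first exact: sqr_ge0.
rewrite mulrCA ler_piMr ?ltW // ltr_pdivrMr // mul1r; have := normr_ge0 c; lra.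
Qed.

Lemma lapl_eq u x l m : lapl u x l -> l = m -> lapl u x m.
Proof. by move=> h <-. Qed.

Lemma eq_lapl u v x l : u =1 v -> lapl u x l -> lapl v x l.
Proof. by move=> /funext ->. Qed.

Lemma laplN u x l : lapl u x l -> lapl (fun z => - u z) x (- l).
Proof.
move=> /(laplZ (-1)) h; apply: lapl_eq (_ : lapl _ x (-1 * l)) _; last by rewrite mulN1r.
by apply: eq_lapl h => z; rewrite mulN1r.
Qed.

Lemma laplB u v x l m : lapl u x l -> lapl v x m -> lapl (fun z => u z - v z) x (l - m).
Proof. by move=> hu /laplN; apply: laplD. Qed.

Lemma lapl_cst (c : R) x : lapl (fun=> c) x 0.
Proof.
move=> e e0; exists 1 => // s s0 _; rewrite /cross.
have -> : c + c + c + c - 4 * c - 0 * s ^+ 2 = 0 by ring.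
by rewrite normr0 mulr_ge0 ?sqr_ge0 // ltW.
Qed.

Lemma lapl_exact u x l : (forall s, cross u x s = l * s ^+ 2) -> lapl u x l.
Proof.
move=> h e e0; exists 1 => // s s0 _; rewrite h subrr normr0.
by rewrite mulr_ge0 ?sqr_ge0 // ltW.
Qed.

Lemma lapl_shift u x l (a b : R) : lapl u (x.1 + a, x.2 + b) l ->
  lapl (fun z => u (z.1 + a, z.2 + b)) x l.
Proof.
move=> h e /h [r r0 hr]; exists r => // s s0 /(hr _ s0).
by rewrite /cross /= ![_ + a + _]addrAC ![_ + b + _]addrAC.
Qed.

Lemma lapl_swap u x l : lapl u (x.2, x.1) l -> lapl (fun z => u (z.2, z.1)) x l.
Proof.
move=> h e /h [r r0 hr]; exists r => // s s0 /(hr _ s0); rewrite /cross /=.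
by rewrite -[_ + u (x.2 + s, _) + _]addrA [_ + (u (x.2 + s, _) + _)]addrC !addrA.
Qed.

Lemma lapl_reflect u x l (a : R) : lapl u (x.1, a - x.2) l ->
  lapl (fun z => u (z.1, a - z.2)) x l.
Proof.
move=> h e /h [r r0 hr]; exists r => // s s0 /(hr _ s0); rewrite /cross /=.
by rewrite -!addrA !opprD !opprK !addrA [_ + u (_, a - x.2 + s) + _]addrAC.
Qed.

Lemma within_continuousP (A : set P) u : {within A, continuous u} <->
  forall x, A x -> forall e, 0 < e ->
    exists2 r, 0 < r & forall z, sq x r z -> A z -> `|u z - u x| <= e.
Proof.
split.
  move=> /subspace_continuousP h x /h /cvgrPdist_le {}h e /h.
  rewrite near_withinE => /nbhs_sqP [r r0 hr].
  by exists r => // z hz Az; rewrite distrC; apply: hr.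
move=> h; apply/subspace_continuousP => x Ax; apply/cvgrPdist_le => e.
move=> /(h _ Ax) [r r0 hr]; rewrite near_withinE; apply/nbhs_sqP.
by exists r => // z hz Az; rewrite /= distrC; apply: hr.
Qed.

Lemma continuous_within (A : set P) u : (forall x, A x -> {for x, continuous u}) ->
  {within A, continuous u}.
Proof. by move=> h; apply: continuous_in_subspaceT => x /set_mem /h. Qed.

(** At a maximum point interior to [K], [cross] is nonpositive for small [s], whereas a positive [l]
    forces it to be at least [l / 2 * s ^+ 2]. *)
Lemma max_principle_strict (K : set P) w (m : R) : compact K -> {within K, continuous w} ->
  (forall x, K x -> w x <= m \/
     ((exists2 r, 0 < r & sq x r `<=` K) /\ exists2 l, 0 < l & lapl w x l)) ->
  forall x, K x -> w x <= m.
Proof.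
move=> cK cw hK x Kx.
have [p /set_mem Kp pmax] := compact_EVT_max (ex_intro _ x Kx) cK cw.
have {}pmax z : K z -> w z <= w p by move=> /mem_set; apply: pmax.
apply: (le_trans (pmax _ Kx)).
case: (hK _ Kp) => // -[[r r0 hr] [l l0 hl]]; exfalso.
have [r' r'0 hr'] := hl (l / 2) (divr_gt0 l0 (ltr0n _ 2)).
pose s := Num.min r r' / 2.
have mr : Num.min r r' <= r by rewrite ge_min lexx.
have mr' : Num.min r r' <= r' by rewrite ge_min lexx orbT.
have m0 : 0 < Num.min r r' by rewrite lt_min r0.
have s0 : 0 < s by rewrite /s; lra.
have sr : s < r by rewrite /s; lra.
have sr' : s < r' by rewrite /s; lra.
have := hr' _ s0 sr'; rewrite /cross.
have b1 : w (p.1 + s, p.2) <= w p by apply: pmax; apply: hr; split => /=; abslra.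
have b2 : w (p.1 - s, p.2) <= w p by apply: pmax; apply: hr; split => /=; abslra.
have b3 : w (p.1, p.2 + s) <= w p by apply: pmax; apply: hr; split => /=; abslra.
have b4 : w (p.1, p.2 - s) <= w p by apply: pmax; apply: hr; split => /=; abslra.
move=> /ler_normlP [h _].
have q0 : 0 < l * s ^+ 2 by rewrite mulr_gt0 // exprn_gt0.
by move: h; rewrite mulrAC; lra.
Qed.

Lemma compact_bounded1 (K : set P) : compact K ->
  exists B : R, forall x, K x -> x.1 ^+ 2 <= B.
Proof.
move=> cK; case: (pselect (K !=set0)) => [K0|K0]; last first.
  by exists 0 => x Kx; exfalso; apply: K0; exists x.
have cf : {within K, continuous (fun x : P => x.1 ^+ 2)}.
  apply: continuous_within => x _; apply: (@cvg_comp _ _ _ fst (fun y => y ^+ 2)).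
    exact: cvg_fst.
  by apply: exprn_continuous.
have [p _ hp] := compact_EVT_max K0 cK cf.
by exists (p.1 ^+ 2) => x /mem_set; apply: hp.
Qed.

Lemma lapl_sqr1 x : lapl (fun z => z.1 ^+ 2) x 2.
Proof. by apply: lapl_exact => s; rewrite /cross /=; ring. Qed.

(** Adding [d * x.1 ^+ 2] makes the Laplacian strictly positive; as [K] is bounded, a small [d]
    changes [w] by at most [e], and [e] is arbitrary. *)
Lemma max_principle (K : set P) w (m : R) : compact K -> {within K, continuous w} ->
  (forall x, K x -> w x <= m \/
     ((exists2 r, 0 < r & sq x r `<=` K) /\ exists2 l, 0 <= l & lapl w x l)) ->
  forall x, K x -> w x <= m.
Proof.
move=> cK cw hK x Kx; have [B hB] := compact_bounded1 cK.
have B0 : 0 <= B by apply: le_trans (hB _ Kx); exact: sqr_ge0.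
apply/ler_addgt0Pr => e e0; pose d := e / (B + 1).
have d0 : 0 < d by rewrite divr_gt0 //; lra.
have dB : d * B <= e.
  rewrite /d mulrAC ler_pdivrMr; last lra.
  by rewrite ler_pM2l //; lra.
suff: w x + d * x.1 ^+ 2 <= m + e.
  have : 0 <= d * x.1 ^+ 2 by rewrite mulr_ge0 ?sqr_ge0 // ltW.
  lra.
apply: (@max_principle_strict K (fun x => w x + d * x.1 ^+ 2)) => //.
- apply: (@within_continuousD _ _ _ K w (fun x => d * x.1 ^+ 2)) => //.
  apply: continuous_within => z _; apply: cvgM; first exact: cvg_cst.
  apply: (@cvg_comp _ _ _ fst (fun y => y ^+ 2)); first exact: cvg_fst.
  by apply: exprn_continuous.
- move=> z Kz; case: (hK _ Kz) => [h|[hin [l l0 hl]]].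
    left; apply: lerD => //; apply: le_trans dB.
    by rewrite ler_pM2l //; exact: hB.
  right; split => //; exists (l + d * 2); first by lra.
  by apply: laplD => //; apply: laplZ; exact: lapl_sqr1.
Qed.

End FivePoint.

(** * Interior bounds for first and second differences of harmonic functions *)

Section InteriorEstimates.
Context {R : realType}.
Local Notation P := (R * R)%type.
Implicit Types (u v w : P -> R) (x : P).

(** This keeps only what the maximum principle consumes, so translates, reflections and coordinate
    swaps inherit it with no derivatives to transport. *)
Definition wharmonic (D : set P) u : Prop :=
  forall x, D x -> {for x, continuous u} /\ lapl u x 0.

Lemma wharmonicD D u v : wharmonic D u -> wharmonic D v -> wharmonic D (fun z => u z + v z).
Proof.
move=> hu hv x Dx; have [cu lu] := hu _ Dx; have [cv lv] := hv _ Dx.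
split; first exact: cvgD.
by apply: lapl_eq (laplD lu lv) _; rewrite addr0.
Qed.

Lemma wharmonicN D u : wharmonic D u -> wharmonic D (fun z => - u z).
Proof.
move=> hu x Dx; have [cu lu] := hu _ Dx; split; first exact: cvgN.
by apply: lapl_eq (laplN lu) _; rewrite oppr0.
Qed.

Lemma wharmonicB D u v : wharmonic D u -> wharmonic D v -> wharmonic D (fun z => u z - v z).
Proof. by move=> hu /wharmonicN; apply: wharmonicD. Qed.

Lemma sub_wharmonic (D D' : set P) u : D' `<=` D -> wharmonic D u -> wharmonic D' u.
Proof. by move=> s h x /s /h. Qed.

Lemma continuous_shift u x (a b : R) : {for (x.1 + a, x.2 + b), continuous u} ->
  {for x, continuous (fun z => u (z.1 + a, z.2 + b))}.
Proof.
move=> /continuous_sqP h; apply/continuous_sqP => e /h [r r0 hr]; exists r => //.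
by move=> z [h1 h2]; apply: hr; split=> /=; abslra.
Qed.

Lemma wharmonic_shift (D D' : set P) u (a b : R) :
  (forall z, D' z -> D (z.1 + a, z.2 + b)) -> wharmonic D u ->
  wharmonic D' (fun z => u (z.1 + a, z.2 + b)).
Proof.
move=> hD hu x /hD /hu [cu lu]; split; first exact: continuous_shift.
exact: lapl_shift.
Qed.

Lemma continuous_swap u x : {for (x.2, x.1), continuous u} ->
  {for x, continuous (fun z => u (z.2, z.1))}.
Proof.
move=> /continuous_sqP h; apply/continuous_sqP => e /h [r r0 hr]; exists r => //.
by move=> z [h1 h2]; apply: hr.
Qed.

Lemma wharmonic_swap (D D' : set P) u :
  (forall z, D' z -> D (z.2, z.1)) -> wharmonic D u ->
  wharmonic D' (fun z => u (z.2, z.1)).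
Proof.
move=> hD hu x /hD /hu [cu lu]; split; first exact: continuous_swap.
exact: lapl_swap.
Qed.

Lemma continuous_reflect u x (a : R) : {for (x.1, a - x.2), continuous u} ->
  {for x, continuous (fun z => u (z.1, a - z.2))}.
Proof.
move=> /continuous_sqP h; apply/continuous_sqP => e /h [r r0 hr]; exists r => //.
by move=> z [h1 h2]; apply: hr; split=> /=; abslra.
Qed.

Lemma continuous1 x : {for x, continuous (@fst R R)}.
Proof. exact: cvg_fst. Qed.

Lemma continuous2 x : {for x, continuous (@snd R R)}.
Proof. exact: cvg_snd. Qed.

(* The odd part of [u] across the line [z.2 = x.2] vanishes on that line, and is
   dominated on the upper half of the square by the harmonic polynomial
   [2M/d^2 ((z.1-x.1)^2 + (z.2-x.2)(2d-(z.2-x.2)))]. *)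
Lemma symmetric_difference_le u x (d M t : R) : 0 < d -> wharmonic (csq x d) u ->
  (forall z, csq x d z -> `|u z| <= M) -> 0 <= t -> t <= d ->
  u (x.1, x.2 + t) - u (x.1, x.2 - t) <= 4 * M / d * t.
Proof.
move=> d0 hu hM t0 td.
have M0 : 0 <= M.
  apply: le_trans (hM x _); first exact: normr_ge0.
  by split; rewrite subrr normr0 ltW.
pose c := 2 * M / d ^+ 2.
have dd0 : 0 < d ^+ 2 by rewrite exprn_gt0.
have c0 : 0 <= c by apply: divr_ge0; [exact: mulr_ge0|exact: ltW].
have cd : c * d ^+ 2 = 2 * M by rewrite /c mulfVK // gt_eqF.
pose b (z : P) := (z.1 - x.1) ^+ 2 + (z.2 - x.2) * (2 * d - (z.2 - x.2)).
pose w z := u z - u (z.1, 2 * x.2 - z.2) - c * b z.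
pose K := [set z : P | (x.1 - d <= z.1 <= x.1 + d) /\ (x.2 <= z.2 <= x.2 + d)].
have K1 z : K z -> csq x d z by move=> [h1 h2]; split; abslra.
have K2 z : K z -> csq x d (z.1, 2 * x.2 - z.2).
  by move=> [h1 h2]; split=> /=; abslra.
have wK : forall z, K z -> w z <= 0.
  apply: max_principle; first exact: compact_rect.
    apply: continuous_within => z Kz; apply: cvgB.
      apply: cvgB; first by case: (hu _ (K1 _ Kz)).
      by apply: continuous_reflect; case: (hu _ (K2 _ Kz)).
    apply: cvgM; first exact: cvg_cst.
    have e1 : {for z, continuous (fun z : P => z.1 - x.1)}.
      by apply: cvgB; [exact: continuous1|exact: cvg_cst].
    have e2 : {for z, continuous (fun z : P => z.2 - x.2)}.
      by apply: cvgB; [exact: continuous2|exact: cvg_cst].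
    apply: cvgD; first by rewrite expr2; apply: cvgM.
    by apply: cvgM => //; apply: cvgB => //; exact: cvg_cst.
  move=> z Kz.
  have := hM _ (K1 _ Kz); have := hM _ (K2 _ Kz) => g1 g2.
  have [h1 h2] := Kz.
  (* On the three sides of [K] off the axis of reflection, [b z] is at least [d ^+ 2], so the
     barrier [c * b z] is at least [2 * M] and dominates the odd part. *)
  have big : d ^+ 2 <= b z -> w z <= 0.
    move=> /(ler_wpM2l c0); rewrite cd /w; unabs; lra.
  have hp : 0 <= (z.2 - x.2) * (2 * d - (z.2 - x.2)).
    by apply: mulr_ge0; unabs; lra.
  have [e1|n1] := eqVneq z.1 (x.1 - d).
    left; apply: big; rewrite /b e1.
    have -> : (x.1 - d - x.1) ^+ 2 = d ^+ 2 by ring.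
    by rewrite lerDl.
  have [e2|n2] := eqVneq z.1 (x.1 + d).
    left; apply: big; rewrite /b e2.
    have -> : (x.1 + d - x.1) ^+ 2 = d ^+ 2 by ring.
    by rewrite lerDl.
  (* On the axis the reflection fixes [z], the odd part vanishes, and the barrier is nonnegative. *)
  have [e3|n3] := eqVneq z.2 x.2.
    left; rewrite /w /b e3 subrr mul0r addr0.
    have -> : (z.1, 2 * x.2 - x.2) = z.
      by rewrite [RHS]surjective_pairing e3; congr pair; ring.
    by rewrite subrr sub0r oppr_le0 mulr_ge0 ?sqr_ge0.
  have [e4|n4] := eqVneq z.2 (x.2 + d).
    left; apply: big; rewrite /b e4.
    have -> : (x.2 + d - x.2) * (2 * d - (x.2 + d - x.2)) = d ^+ 2 by ring.
    by rewrite lerDr sqr_ge0.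
  right; split.
    move: h1 h2 => /andP[]; rewrite !le_eqVlt eq_sym (negbTE n1) (negbTE n2) /= => h1 h2.
    move=> /andP[]; rewrite eq_sym (negbTE n3) (negbTE n4) /= => h3 h4.
    pose r := Num.min (Num.min (z.1 - (x.1 - d)) (x.1 + d - z.1))
      (Num.min (z.2 - x.2) (x.2 + d - z.2)).
    exists r; first by rewrite !lt_min !subr_gt0 h1 h2 h3 h4.
    move=> y []; rewrite !lt_min => /andP[/andP[a1 a2] _] /andP[_ /andP[a3 a4]].
    by unabs; split; apply/andP; split; lra.
  exists (0 - 0 - c * 0); first by lra.
  apply: laplB; last first.
    by apply: laplZ; apply: lapl_exact => s; rewrite /cross /b /=; ring.
  apply: laplB; first by case: (hu _ (K1 _ Kz)).
  by apply: lapl_reflect; case: (hu _ (K2 _ Kz)).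
have Kt : K (x.1, x.2 + t) by split=> /=; apply/andP; split; lra.
have := wK _ Kt; rewrite /w /b /= subrr expr0n /= add0r.
have -> : 2 * x.2 - (x.2 + t) = x.2 - t by ring.
have -> : x.2 + t - x.2 = t by ring.
have -> : 4 * M / d * t = c * (t * (2 * d)).
  by rewrite /c; field; rewrite gt_eqF.
have : c * (t * (2 * d - t)) <= c * (t * (2 * d)) by apply: ler_wpM2l => //; nra.
lra.
Qed.

(** The boolean selects the axis, [true] for the first, so that a single statement serves both
    partial derivatives. *)
Definition sh (b : bool) (z : P) (t : R) : P :=
  if b then (z.1 + t, z.2) else (z.1, z.2 + t).

(** The symmetric estimate is applied at the midpoint [p] of the segment, with half-step [t / 2] in
    a square of half-side [d / 2]; the two halvings cancel in the constant. *)
Lemma vertical_difference_le u x (d M t : R) (z : P) : 0 < d -> wharmonic (sq x d) u ->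
  (forall z, sq x d z -> `|u z| <= M) -> 0 <= t ->
  sq x (d / 2) z -> sq x (d / 2) (z.1, z.2 + t) ->
  u (z.1, z.2 + t) - u z <= 4 * M / d * t.
Proof.
move=> d0 hu hM t0 h1 h2.
pose p : P := (z.1, z.2 + t / 2).
have sub : csq p (d / 2) `<=` sq x d.
  by move: h1 h2 => [a1 a2] [/= a3 a4]; apply: subcsq; rewrite /p /=; abslra.
have d20 : 0 < d / 2 by lra.
have t20 : 0 <= t / 2 by lra.
have td : t / 2 <= d / 2 by move: h1 h2 => [a1 a2] [/= a3 a4]; unabs; lra.
have := symmetric_difference_le d20 (sub_wharmonic sub hu)
  (fun z hz => hM _ (sub _ hz)) t20 td.
rewrite /p /=.
have -> : z.2 + t / 2 + t / 2 = z.2 + t by field.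
have -> : z.2 + t / 2 - t / 2 = z.2 by ring.
rewrite -surjective_pairing => h; apply: (le_trans h); rewrite le_eqVlt; apply/orP; left.
by apply/eqP; field; rewrite gt_eqF.
Qed.

(** Three symmetries reduce this to the vertical estimate: swapping coordinates, exchanging
    endpoints when [t] is negative, and replacing [u] by [- u] for the lower bound. *)
Lemma lipschitz_le u x (d M : R) b (z : P) t : 0 < d -> wharmonic (sq x d) u ->
  (forall z, sq x d z -> `|u z| <= M) ->
  sq x (d / 2) z -> sq x (d / 2) (sh b z t) ->
  `|u (sh b z t) - u z| <= 4 * M / d * `|t|.
Proof.
move=> d0.
wlog: u x z b / b = false.
  move=> wl hu hM; case: b; last exact: wl.
  move=> h1 h2.
  pose u' z := u (z.2, z.1).
  have := wl u' (x.2, x.1) (z.2, z.1) false erefl _ _ _ _.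
  rewrite /u' /= -surjective_pairing; apply.
  - by apply: (wharmonic_swap _ hu) => y [].
  - by move=> y [? ?]; apply: hM.
  - by case: h1.
  - by case: h2.
move=> -> hu hM; rewrite /sh.
wlog t0 : z t / 0 <= t.
  move=> wl h1 h2; have [t0|t0] := leP 0 t; first exact: wl.
  have := wl (z.1, z.2 + t) (- t) _ h2 _; rewrite /= addrK -surjective_pairing.
  by rewrite normrN distrC; apply => //; lra.
move=> h1 h2; rewrite [`|t|]ger0_norm //; apply/ler_normlP; split.
  have hM' y : sq x d y -> `|- u y| <= M by rewrite normrN; exact: hM.
  have := vertical_difference_le d0 (wharmonicN hu) hM' t0 h1 h2; lra.
exact: vertical_difference_le hu hM t0 h1 h2.
Qed.

(** The increment [v] of [u] by [h] is again harmonic on a square of half-side [d / 4], where the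
    Lipschitz estimate bounds it by [4 * M / d * |h|]. A second use of that estimate, now on [v],
    gives [64 = 4 * 4 * 4]. *)
Lemma double_difference_le u x (d M : R) b c (z : P) t h : 0 < d ->
  wharmonic (sq x d) u ->
  (forall z, sq x d z -> `|u z| <= M) -> `|h| < d / 4 ->
  sq x (d / 8) z -> sq x (d / 8) (sh b z t) ->
  `|u (sh c (sh b z t) h) - u (sh b z t) - (u (sh c z h) - u z)|
    <= 64 * M / d ^+ 2 * `|h| * `|t|.
Proof.
move=> d0 hu hM hd h1 h2.
pose v z := u (sh c z h) - u z.
have s4 y : sq x (d / 4) y -> sq x (d / 2) (sh c y h).
  by move=> [a1 a2]; rewrite /sh; case: c {v} => /=; split => /=; abslra.
have s4' y : sq x (d / 4) y -> sq x (d / 2) y.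
  by move=> [a1 a2]; split => /=; abslra.
have s2 y : sq x (d / 2) y -> sq x d y.
  by move=> [a1 a2]; split => /=; abslra.
have hv : wharmonic (sq x (d / 4)) v.
  apply: wharmonicB; last by apply: sub_wharmonic hu => y /s4' /s2.
  have : forall y, sq x (d / 4) y -> sq x d (sh c y h) by move=> y /s4 /s2.
  rewrite /sh; case: c {v s4} => hh.
    have -> : (fun z => u (z.1 + h, z.2)) = (fun z => u (z.1 + h, z.2 + 0)).
      by apply/funext => y; rewrite addr0.
    by apply: (wharmonic_shift _ hu) => y /hh; rewrite addr0.
  have -> : (fun z => u (z.1, z.2 + h)) = (fun z => u (z.1 + 0, z.2 + h)).
    by apply/funext => y; rewrite addr0.
  by apply: (wharmonic_shift _ hu) => y /hh; rewrite addr0.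
have hvM y : sq x (d / 4) y -> `|v y| <= 4 * M / d * `|h|.
  move=> hy; apply: (lipschitz_le d0 hu hM); [exact: s4'|exact: s4].
have d40 : 0 < d / 4 by lra.
have e8 : d / 4 / 2 = d / 8 by field.
have := lipschitz_le d40 hv hvM; rewrite e8 => /(_ b z t h1 h2) h3.
apply: (le_trans h3); rewrite le_eqVlt; apply/orP; left.
by apply/eqP; field; rewrite gt_eqF.
Qed.

End InteriorEstimates.

(** * Harnack's inequality, locally and then on a connected open set *)

Section Harnack.
Context {R : realType}.
Local Notation P := (R * R)%type.
Implicit Types (u v w : P -> R) (x p : P).

Definition dist2 (p z : P) : R := (z.1 - p.1) ^+ 2 + (z.2 - p.2) ^+ 2.

Lemma continuous_dist2 p x : {for x, continuous (dist2 p)}.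
Proof.
have e1 : {for x, continuous (fun z : P => z.1 - p.1)}.
  by apply: cvgB; [exact: continuous1|exact: cvg_cst].
have e2 : {for x, continuous (fun z : P => z.2 - p.2)}.
  by apply: cvgB; [exact: continuous2|exact: cvg_cst].
by apply: cvgD; rewrite expr2; apply: cvgM.
Qed.

(** A rational subharmonic barrier: its second differences have a closed form, so the limit is
    computed by field arithmetic and continuity. *)
Lemma lapl_inv_dist2 p x : 0 < dist2 p x ->
  lapl (fun z => (dist2 p z)^-1) x (4 / dist2 p x ^+ 2).
Proof.
set a := x.1 - p.1; set b := x.2 - p.2; rewrite /dist2 -/a -/b.
set A := a ^+ 2 + b ^+ 2 => A0 e e0.
have An0 : A != 0 by rewrite gt_eqF.
(* [F c s] is the exact second difference of the reciprocal along one axis divided by [s ^+ 2],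
   where [c] is the offset from [p] on that axis; [key] verifies this. *)
pose F (c s : R) := 2 * (4 * c ^+ 2 - A - s ^+ 2) /
  (A * ((A + s ^+ 2) ^+ 2 - 4 * c ^+ 2 * s ^+ 2)).
have c2 : (s ^+ 2 @[s --> (0 : R)]) --> (0 : R).
  by have := @exprn_continuous R 2 0; rewrite /continuous_at expr0n.
have cF c : F c s @[s --> (0 : R)] --> F c 0.
  rewrite /F expr0n /= subr0 mulr0 subr0 addr0.
  apply: cvgM.
    apply: cvgM; first exact: cvg_cst.
    rewrite -[X in _ --> X]subr0; apply: cvgB => //; exact: cvg_cst.
  apply: cvgV; first by rewrite mulf_neq0 // sqrf_eq0.
  apply: cvgM; first exact: cvg_cst.
  have cA : (A + s ^+ 2 @[s --> (0 : R)]) --> A.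
    by rewrite -[X in _ --> X]addr0; apply: cvgD => //; exact: cvg_cst.
  have c4 : (4 * c ^+ 2 * s ^+ 2 @[s --> (0 : R)]) --> (0 : R).
    rewrite -[X in _ --> X](mulr0 (4 * c ^+ 2)).
    by apply: cvgM => //; exact: cvg_cst.
  rewrite -[X in _ --> X]subr0; apply: cvgB => //.
  by apply: (@cvg_comp _ _ _ (fun s => A + s ^+ 2) (fun y => y ^+ 2) _ _ _ cA); exact: exprn_continuous.
have cFF : (F a s + F b s @[s --> (0 : R)]) --> F a 0 + F b 0 by apply: cvgD.
have F0 : F a 0 + F b 0 = 4 / A ^+ 2.
  by rewrite /F; move: An0; rewrite /A => An0; field.
move/cvgrPdist_le : cFF => /(_ _ e0) /nbhs_ballP [r r0 hr].
(* From [s < 1] and [s < A] follows [s ^+ 2 < A], which keeps the four displaced points away from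
   the pole [p]. *)
exists (Num.min r (Num.min 1 A)); first by rewrite !lt_min r0 A0 ltr01.
move=> s s0; rewrite !lt_min => /andP[s1 /andP[s2 s3]].
have {hr} := hr s _; rewrite -ball_normE /= sub0r normrN gtr0_norm // => /(_ s1).
have ss : s ^+ 2 < A by apply: lt_trans s3; rewrite expr2 gtr_pMr.
have ss0 : 0 < s ^+ 2 by rewrite exprn_gt0.
have nz1 (c d : R) : c ^+ 2 + d ^+ 2 = A -> (c + s) ^+ 2 + d ^+ 2 != 0.
  move=> E; apply/eqP => h.
  have /eqP : c + s = 0.
    by apply/eqP; rewrite -sqrf_eq0; apply/eqP; have := sqr_ge0 (c + s);
       have := sqr_ge0 d; lra.
  rewrite addr_eq0 => /eqP cs; move: E h; rewrite cs addNr expr0n /= add0r sqrrN; lra.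
have nz2 (c d : R) : c ^+ 2 + d ^+ 2 = A -> (c - s) ^+ 2 + d ^+ 2 != 0.
  move=> E; rewrite -sqrrN opprB addrC addrC [s - c]addrC.
  by apply: nz1; rewrite sqrrN.
have key (c d : R) : c ^+ 2 + d ^+ 2 = A ->
  ((c + s) ^+ 2 + d ^+ 2)^-1 + ((c - s) ^+ 2 + d ^+ 2)^-1 = F c s * s ^+ 2 + 2 / A.
  move=> E; have := nz1 _ _ E; have := nz2 _ _ E => n2 n1; rewrite /F.
  have -> : (A + s ^+ 2) ^+ 2 - 4 * c ^+ 2 * s ^+ 2 =
    ((c + s) ^+ 2 + d ^+ 2) * ((c - s) ^+ 2 + d ^+ 2) by rewrite -E; ring.
  have : c ^+ 2 + d ^+ 2 != 0 by rewrite E.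
  by rewrite -E => n3; field; rewrite n1 n2 n3.
have k1 := key a b erefl; have k2 := key b a (addrC _ _).
rewrite F0 => h.
have -> : cross (fun z : P => ((z.1 - p.1) ^+ 2 + (z.2 - p.2) ^+ 2)^-1) x s =
   (F a s + F b s) * s ^+ 2.
  rewrite /cross /= -/a -/b.
  have -> : x.1 + s - p.1 = a + s by rewrite /a; ring.
  have -> : x.1 - s - p.1 = a - s by rewrite /a; ring.
  have -> : x.2 + s - p.2 = b + s by rewrite /b; ring.
  have -> : x.2 - s - p.2 = b - s by rewrite /b; ring.
  rewrite -/A ![a ^+ 2 + _]addrC; lra.
by rewrite -mulrBl normrM (gtr0_norm ss0) distrC ler_pM2r.
Qed.

Lemma dist2_ge p z (r : R) : 0 <= r -> ~ sq p r z -> r ^+ 2 <= dist2 p z.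
Proof.
move=> r0 h; rewrite /dist2.
have [h1|h1] := leP r `|z.1 - p.1|.
  apply: (@le_trans _ _ (`|z.1 - p.1| ^+ 2)); first by rewrite ler_sqr ?nnegrE.
  by rewrite real_normK ?num_real // lerDl sqr_ge0.
have [h2|h2] := leP r `|z.2 - p.2|; last by exfalso; apply: h; split.
apply: (@le_trans _ _ (`|z.2 - p.2| ^+ 2)); first by rewrite ler_sqr ?nnegrE.
by rewrite real_normK ?num_real // lerDr sqr_ge0.
Qed.

(* Comparison on the square annulus between [sq p rho] and [csq p L] with the
   subharmonic function [m rho^2 (1/|z-p|^2 - 1/L^2)]. *)
Lemma annulus_lower_bound u p (L rho m : R) : 0 < rho -> 0 <= m ->
  wharmonic (csq p L) u -> (forall z, csq p L z -> 0 <= u z) ->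
  (forall z, csq p rho z -> m <= u z) ->
  forall z, csq p L z -> ~ sq p rho z ->
  m * rho ^+ 2 * ((dist2 p z)^-1 - (L ^+ 2)^-1) <= u z.
Proof.
move=> rho0 m0 hu u0 um z hz nz.
have L0 : 0 <= L by case: hz => h _; apply: le_trans h; exact: normr_ge0.
have rr0 : 0 < rho ^+ 2 by rewrite exprn_gt0.
pose w z := m * rho ^+ 2 * ((dist2 p z)^-1 - (L ^+ 2)^-1) - u z.
pose K := csq p L `&` ~` sq p rho.
suff : w z <= 0 by rewrite /w; lra.
have dpos y : ~ sq p rho y -> 0 < dist2 p y.
  by move=> /(dist2_ge (ltW rho0)); apply: lt_le_trans.
apply: (@max_principle _ K) => //.
- apply: (@subclosed_compact _ _ (csq p L)); last by move=> y [].
    apply: closedI; last by apply: open_closedC; exact: open_sq.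
    apply: compact_closed; last exact: compact_csq.
    exact: norm_hausdorff.
  exact: compact_csq.
- apply: continuous_within => y [y1 y2]; apply: cvgB; last by case: (hu _ y1).
  apply: cvgM; first exact: cvg_cst.
  apply: cvgB; last exact: cvg_cst.
  by apply: cvgV; [rewrite gt_eqF // dpos|exact: continuous_dist2].
move=> y [y1 y2].
have c0 : 0 <= m * rho ^+ 2 by rewrite mulr_ge0 // ltW.
(* On the inner edge [dist2 p y >= rho ^+ 2], so the barrier is at most [m], hence at most [u y]. *)
have [h1|h1] := pselect (csq p rho y).
  left; rewrite /w subr_le0; apply: le_trans (um _ h1).
  apply: (@le_trans _ _ (m * rho ^+ 2 * (rho ^+ 2)^-1)).
    apply: ler_wpM2l => //.
    have : (dist2 p y)^-1 <= (rho ^+ 2)^-1.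
      by rewrite lef_pV2 ?posrE ?dpos // dist2_ge // ltW.
    have : 0 <= (L ^+ 2)^-1 by rewrite invr_ge0 sqr_ge0.
    lra.
  by rewrite mulfK // gt_eqF.
(* On the outer edge [dist2 p y >= L ^+ 2], so the barrier is nonpositive and [u y] is
   nonnegative. *)
have [h2|h2] := pselect (sq p L y); last first.
  have LL0 : 0 < L.
    rewrite lt_neqAle L0 andbT; apply/eqP => L00; apply: h1.
    by case: y1; rewrite -L00 => a1 a2; split; [apply: le_trans a1 _|apply: le_trans a2 _]; exact: ltW.
  left; rewrite /w subr_le0; apply: le_trans (u0 _ y1).
  apply: mulr_ge0_le0 => //; rewrite subr_le0.
  by rewrite lef_pV2 ?posrE ?dpos ?exprn_gt0 // dist2_ge.
right; split.
  have oK : open (sq p L `&` ~` csq p rho).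
    apply: openI; first exact: open_sq.
    apply: closed_openC; apply: compact_closed; last exact: compact_csq.
    exact: norm_hausdorff.
  have [r r0 hr] := (open_sqP _).1 oK y (conj h2 h1).
  exists r => // x /hr [x1 x2]; split; first exact: sq_csq.
  by move=> /sq_csq.
exists (m * rho ^+ 2 * (4 / dist2 p y ^+ 2 - 0) - 0).
  by rewrite !subr0 mulr_ge0 // divr_ge0 // sqr_ge0.
apply: laplB; last by case: (hu _ y1).
apply: laplZ; apply: laplB; last exact: lapl_cst.
by apply: lapl_inv_dist2; apply: dpos.
Qed.

(* The weight [(r - |z - x|)^2] makes the maximum [p] see a value at most four times
   larger on a square around it, so the gradient bound keeps [u] above half its
   value at [p] on a comparable square; the annulus barrier then carries this to [x]. *)
Lemma harnack_local u x (r : R) : 0 < r -> wharmonic (sq x (4 * r)) u ->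
  (forall z, sq x (4 * r) z -> 0 <= u z) ->
  forall z, sq x (r / 2) z -> u z <= 32 * 128 ^+ 2 * u x.
Proof.
move=> r0 hu u0.
pose N (z : P) : R := Num.max `|z.1 - x.1| `|z.2 - x.2|.
have N0 z : 0 <= N z by rewrite le_max normr_ge0.
have cN z : {for z, continuous N}.
  apply: continuous_max; apply: cvg_norm; apply: cvgB; try exact: cvg_cst.
    exact: continuous1.
  exact: continuous2.
pose w z := u z * (r - N z) ^+ 2.
have sub1 : csq x r `<=` sq x (4 * r).
  by apply: subcsq; rewrite subrr normr0; lra.
have cw : {within csq x r, continuous w}.
  apply: continuous_within => z /sub1 hz; apply: cvgM; first by case: (hu _ hz).
  have cc : {for z, continuous (fun z => r - N z)}.
    by apply: cvgB; [exact: cvg_cst|exact: cN].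
  by rewrite expr2; apply: cvgM.
have xin : csq x r x by split; rewrite subrr normr0 ltW.
have [p /set_mem hp pmax] := compact_EVT_max (ex_intro _ x xin) (@compact_csq R x r) cw.
have {}pmax z : csq x r z -> w z <= w p by move=> /mem_set; apply: pmax.
have ux0 : 0 <= u x by apply: u0; apply: sub1.
have up0 : 0 <= u p by apply: u0; apply: sub1.
have Npr : N p <= r by rewrite ge_max; case: hp => -> ->.
pose d := r - N p.
(* On [sq x (r / 2)] the weight is at least [(r / 2) ^+ 2], so dividing by it turns [8 * r ^+ 2]
   into [32]. *)
suff main : w p <= 8 * 128 ^+ 2 * r ^+ 2 * u x.
  move=> z hz.
  have zin : csq x r z by case: hz => a1 a2; split; apply: ltW; lra.
  have uz0 : 0 <= u z by apply: u0; apply: sub1.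
  have Nz : N z <= r / 2 by rewrite ge_max; case: hz => /ltW -> /ltW ->.
  have := le_trans (pmax _ zin) main; rewrite /w => h.
  have h' : u z * (r / 2) ^+ 2 <= 8 * 128 ^+ 2 * r ^+ 2 * u x.
    apply: le_trans h; apply: ler_wpM2l => //.
    by rewrite ler_sqr ?nnegrE; lra.
  have r20 : 0 < (r / 2) ^+ 2 by rewrite exprn_gt0 // divr_gt0.
  rewrite -(ler_pM2r r20); apply: (le_trans h').
  by rewrite le_eqVlt; apply/orP; left; apply/eqP; field.
have [d0|d0] := leP d 0.
  rewrite /w.
  have -> : r - N p = 0 by move: d0; rewrite /d; lra.
  by rewrite expr0n mulr0 mulr_ge0 // mulr_ge0 // sqr_ge0.
(* Within [d / 2] of [p] the quantity [r - N] stays above half its value [d] at [p]; maximality of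
   [w p] then costs a factor [2 ^+ 2]. *)
have near4 z : sq p (d / 2) z -> csq x r z /\ u z <= 4 * u p.
  move=> [z1 z2].
  have [p1 p2] : `|p.1 - x.1| <= N p /\ `|p.2 - x.2| <= N p.
    by rewrite /N !le_max !lexx orbT.
  have Nz : N z <= r - d / 2.
    rewrite /N ge_max; apply/andP; split.
      have := ler_distD p.1 z.1 x.1; rewrite /d in z1 *; lra.
    have := ler_distD p.2 z.2 x.2; rewrite /d in z2 *; lra.
  have zin : csq x r z.
    by move: Nz; rewrite /N ge_max => /andP[a1 a2]; split; lra.
  split => //; have := pmax _ zin; rewrite /w -/d => h.
  have uz0 : 0 <= u z by apply: u0; apply: sub1.
  have h' : u z * (d / 2) ^+ 2 <= u p * d ^+ 2.
    apply: le_trans h; apply: ler_wpM2l => //.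
    by rewrite ler_sqr ?nnegrE; lra.
  have d20 : 0 < (d / 2) ^+ 2 by rewrite exprn_gt0 // divr_gt0.
  rewrite -(ler_pM2r d20); apply: (le_trans h').
  by rewrite le_eqVlt; apply/orP; left; apply/eqP; field.
have d20 : 0 < d / 2 by lra.
have hup : wharmonic (sq p (d / 2)) u.
  by apply: sub_wharmonic hu => z /near4 [/sub1].
have bup z : sq p (d / 2) z -> `|u z| <= 4 * u p.
  by move=> /near4 [/sub1 /u0 hz ?]; rewrite ger0_norm.
(* The Lipschitz constant near [p] is [4 * (4 * u p) / (d / 2) = 32 * u p / d], so a displacement of
   [d / 128] along each axis lowers [u] by at most [u p / 4], in total [u p / 2]. *)
pose rho := d / 128.
have rho0 : 0 < rho by rewrite /rho; lra.
have half z : csq p rho z -> u p / 2 <= u z.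
  move=> [z1 z2].
  pose y : P := sh true p (z.1 - p.1).
  have ye : y = (z.1, p.2) by rewrite /y /sh; congr pair; ring.
  have ze : z = sh false y (z.2 - p.2).
    by rewrite ye /sh [LHS]surjective_pairing /=; congr pair; ring.
  have pin : sq p (d / 2 / 2) p by apply: sq_center; lra.
  have yin : sq p (d / 2 / 2) y.
    by rewrite ye; split => /=; rewrite ?subrr ?normr0; rewrite /rho in z1 z2; lra.
  have zin : sq p (d / 2 / 2) z.
    by split => /=; rewrite /rho in z1 z2; lra.
  have l1 : `|u y - u p| <= 4 * (4 * u p) / (d / 2) * `|z.1 - p.1|.
    exact: lipschitz_le d20 hup bup pin yin.
  have l2 : `|u z - u y| <= 4 * (4 * u p) / (d / 2) * `|z.2 - p.2|.
    by rewrite [in X in X <= _]ze; apply: lipschitz_le d20 hup bup yin _; rewrite -ze.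
  have c0 : 0 <= 4 * (4 * u p) / (d / 2).
    by apply: divr_ge0; [rewrite !mulr_ge0|exact: ltW].
  have ce : 4 * (4 * u p) / (d / 2) * rho = u p / 4.
    by rewrite /rho; field; rewrite gt_eqF.
  have := ler_wpM2l c0 z1; have := ler_wpM2l c0 z2; rewrite ce => l3 l4.
  by unabs; lra.
have sub2 : csq p (2 * r) `<=` sq x (4 * r).
  by case: hp => p1 p2; apply: subcsq; lra.
have u20 : 0 <= u p / 2 by lra.
have drle : rho <= r by rewrite /rho /d; have := N0 p; lra.
have low : u p / 2 * rho ^+ 2 <= 4 * r ^+ 2 * u x.
  have [xin'|xout] := pselect (sq p rho x).
    have h1 := half _ (sq_csq xin').
    have h2 : rho ^+ 2 <= r ^+ 2 by rewrite ler_sqr ?nnegrE //; lra.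
    apply: (@le_trans _ _ (u x * r ^+ 2)).
      apply: ler_pM => //; exact: sqr_ge0.
    have : 0 <= u x * r ^+ 2 by rewrite mulr_ge0 // sqr_ge0.
    lra.
  have xin' : csq p (2 * r) x.
    by case: hp => p1 p2; split; rewrite distrC; lra.
  have := annulus_lower_bound rho0 u20 (sub_wharmonic sub2 hu)
    (fun z hz => u0 _ (sub2 _ hz)) half xin' xout.
  have dp : 0 < dist2 p x.
    by apply: lt_le_trans (dist2_ge (ltW rho0) xout); rewrite exprn_gt0.
  have dl : dist2 p x <= 2 * r ^+ 2.
    rewrite /dist2; case: hp => p1 p2.
    have : (x.1 - p.1) ^+ 2 <= r ^+ 2.
      by rewrite -[(x.1 - p.1) ^+ 2]real_normK ?num_real // ler_sqr ?nnegrE // 1?distrC // ltW.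
    have : (x.2 - p.2) ^+ 2 <= r ^+ 2.
      by rewrite -[(x.2 - p.2) ^+ 2]real_normK ?num_real // ler_sqr ?nnegrE // 1?distrC // ltW.
    lra.
  have rr0 : 0 < r ^+ 2 by rewrite exprn_gt0.
  (* The outer half-side [2 * r] exceeds the Euclidean distance from [p] to [x], at most
     [sqrt 2 * r], so the barrier is positive at [x]. *)
  have q : (4 * r ^+ 2)^-1 <= (dist2 p x)^-1 - ((2 * r) ^+ 2)^-1.
    have : (2 * r ^+ 2)^-1 <= (dist2 p x)^-1 by rewrite lef_pV2 ?posrE // mulr_gt0.
    have -> : (2 * r ^+ 2)^-1 = (4 * r ^+ 2)^-1 + ((2 * r) ^+ 2)^-1.
      by field; rewrite gt_eqF.
    lra.
  move=> h; have {h} : u p / 2 * rho ^+ 2 * (4 * r ^+ 2)^-1 <= u x.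
    apply: le_trans h; apply: ler_wpM2l => //.
    by rewrite mulr_ge0 // sqr_ge0.
  by rewrite ler_pdivrMr ?mulr_gt0 // [u x * _]mulrC.
have e : rho ^+ 2 * 128 ^+ 2 = d ^+ 2 by rewrite /rho; field.
rewrite /w -/d -e; lra.
Qed.

(** The points near which [u x] controls every nonnegative harmonic [u], with a constant independent
    of [u], form a nonempty subset of [D] that is open and relatively closed. *)
Lemma harnack (D : set P) x : open D -> connected D -> D x ->
  forall y, D y -> exists C r : R, [/\ 0 <= C, 0 < r, sq y r `<=` D &
    forall u, wharmonic D u -> (forall z, D z -> 0 <= u z) ->
      forall z, sq y r z -> u z <= C * u x].
Proof.
move=> oD cD Dx.
pose good y := exists C r : R, [/\ 0 <= C, 0 < r, sq y r `<=` D &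
    forall u, wharmonic D u -> (forall z, D z -> 0 <= u z) ->
      forall z, sq y r z -> u z <= C * u x].
have loc y : D y -> exists2 r, 0 < r & sq y (4 * r) `<=` D.
  move=> /((open_sqP _).1 oD) [r r0 hr]; exists (r / 4); first by lra.
  by have -> : 4 * (r / 4) = r by field.
pose B := D `&` good.
have oB : open B.
  apply/open_sqP => y [Dy [C [r [C0 r0 sD hC]]]]; exists (r / 2); first by lra.
  move=> z [z1 z2].
  have sz : sq z (r / 2) `<=` sq y r by apply: subsq; lra.
  split; first by apply: sD; apply: sz; apply: sq_center; lra.
  exists C, (r / 2); split => //; first by lra.
    by move=> t /sz /sD.
  by move=> u hu u0 t /sz; exact: hC.
suff BD : B = D by move=> y Dy; have [] : B y by rewrite BD.
apply: cD.
- exists x; split => //; have [r r0 hr] := loc _ Dx.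
  exists (32 * 128 ^+ 2), (r / 2); split; [by []|by lra| |].
    by apply: subset_trans hr; apply: subsq; rewrite subrr normr0; lra.
  move=> u hu u0; apply: harnack_local => //; first exact: sub_wharmonic hu.
  by move=> z /hr /u0.
- by exists B => //; rewrite setIA setIid.
exists (closure B); first exact: closed_closure.
apply/seteqP; split=> [y By|y [Dy cBy]].
  by split; [case: By|exact: subset_closure].
split => //; have [r r0 hr] := loc _ Dy.
have : nbhs y (sq y (r / 8)) by apply/nbhs_sqP; exists (r / 8) => //; lra.
move=> /cBy [z [[Dz [C [s [C0 s0 sD hC]]]] [z1 z2]]].
(* A good point [z] within [r / 8] of [y] is close enough for the local inequality at [z], at scale
   [r / 2], to cover a square around [y]; the two constants multiply. *)
have szy : sq z (4 * (r / 2)) `<=` sq y (4 * r) by apply: subsq; lra.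
have syz : sq y (r / 8) `<=` sq z (r / 2 / 2).
  by apply: subsq; rewrite distrC; lra.
exists (32 * 128 ^+ 2 * C), (r / 8); split; first by rewrite mulr_ge0.
- by lra.
- by apply: subset_trans hr; apply: subsq; rewrite subrr normr0; lra.
move=> u hu u0 t /syz tz.
have r20 : 0 < r / 2 by lra.
have szD : sq z (4 * (r / 2)) `<=` D by apply: subset_trans hr.
apply: (le_trans (harnack_local r20 (sub_wharmonic szD hu) _ tz)).
  by move=> a /szD /u0.
rewrite -[leRHS]mulrA ler_pM2l; last lra.
by apply: hC => //; exact: sq_center.
Qed.

End Harnack.

(** * Partial derivatives as first-order expansions, and the passage from classical to five-point
    harmonicity *)

Section Partials.
Context {R : realType}.
Local Notation P := (R * R)%type.
Implicit Types (u v w : P -> R) (x : P).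

(** Clearing the denominator admits [h = 0] and leaves estimates linear in the increments, which
    combine without quotients. *)
Lemma derive1_smallo (f : R -> R) (a l : R) :
  (derivable f a 1 /\ derive1 f a = l) <->
  forall e, 0 < e -> exists2 r, 0 < r & forall h, `|h| < r ->
    `|f (a + h) - f a - l * h| <= e * `|h|.
Proof.
pose F h := h^-1 *: (f (h + a) - f a).
have FE : (fun h : R => h^-1 *: ((f \o shift a) (h *: (1 : R)) - f a)) = F.
  by apply/funext => h /=; rewrite /F /GRing.scale /= mulr1.
have Fl h : h != 0 -> `|l - F h| * `|h| = `|f (a + h) - f a - l * h|.
  move=> h0; rewrite -normrM mulrBl /F /GRing.scale /= mulrAC mulVf // mul1r.
  by rewrite distrC [h + a]addrC.
split.
  move=> [df dl].
  have : F h @[h --> 0^'] --> l by move: df; rewrite /derivable FE -dl /derive1.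
  move=> /cvgrPdist_le h e /h; rewrite near_withinE => /nbhs_ballP [r r0 hr].
  exists r => // t tr; have [->|t0] := eqVneq t 0.
    by rewrite addr0 subrr sub0r mulr0 normrN normr0 mulr0.
  rewrite -Fl // ler_pM2r ?normr_gt0 //; apply: hr => //.
  by rewrite -ball_normE /= sub0r normrN.
move=> h.
have cF : F h @[h --> 0^'] --> l.
  apply/cvgrPdist_le => e /h [r r0 hr]; rewrite near_withinE; apply/nbhs_ballP.
  exists r => // t; rewrite -ball_normE /= sub0r normrN => /hr ht t0.
  by rewrite -(@ler_pM2r _ `|t|) ?normr_gt0 // Fl.
split; first by rewrite /derivable FE; apply/cvg_ex; exists l.
by rewrite /derive1; apply/cvg_lim.
Qed.

Definition pd (b : bool) u x : R := if b then partial1 u x else partial2 u x.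
Definition has_pd (b : bool) u x : Prop :=
  if b then has_partial1 u x else has_partial2 u x.

Definition pdlim (b : bool) u x (l : R) : Prop :=
  forall e, 0 < e -> exists2 r, 0 < r & forall h, `|h| < r ->
    `|u (sh b x h) - u x - l * h| <= e * `|h|.

Lemma pdP b u x l : (has_pd b u x /\ pd b u x = l) <-> pdlim b u x l.
Proof.
by case: b; rewrite /has_pd /pd /has_partial1 /has_partial2 /partial1 /partial2 /pdlim
  derive1_smallo /sh -surjective_pairing.
Qed.

Lemma pdlim_pd b u x : has_pd b u x -> pdlim b u x (pd b u x).
Proof. by move=> h; apply/pdP. Qed.

Lemma pdlimB b u v x l m : pdlim b u x l -> pdlim b v x m ->
  pdlim b (fun z => u z - v z) x (l - m).
Proof.
move=> hu hv e e0; have e2 : 0 < e / 2 by lra.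
have [r r0 hr] := hu _ e2; have [r' r'0 hr'] := hv _ e2.
exists (Num.min r r'); first by rewrite lt_min r0.
move=> h; rewrite lt_min => /andP[/hr h1 /hr' h2].
have -> : u (sh b x h) - v (sh b x h) - (u x - v x) - (l - m) * h =
  u (sh b x h) - u x - l * h - (v (sh b x h) - v x - m * h) by ring.
apply: (le_trans (ler_normB _ _)); lra.
Qed.

(** This transfers a bound on differences of increments to derivatives. Functions and base points
    may both differ, so it serves for Cauchy estimates, for uniform convergence and for Lipschitz
    bounds on derivatives. *)
Lemma pdlim_dist_le b v w y z (l m K : R) : pdlim b v y l -> pdlim b w z m ->
  (exists2 r, 0 < r & forall h, `|h| < r ->
     `|v (sh b y h) - v y - (w (sh b z h) - w z)| <= K * `|h|) -> `|l - m| <= K.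
Proof.
move=> hv hw [r r0 hr]; apply/ler_addgt0Pr => e e0; have e2 : 0 < e / 2 by lra.
have [s s0 hs] := hv _ e2; have [t t0 ht] := hw _ e2.
pose h := Num.min r (Num.min s t) / 2.
have m0 : 0 < Num.min r (Num.min s t) by rewrite !lt_min r0 s0.
have h0 : 0 < h by rewrite /h; lra.
have : h < Num.min r (Num.min s t) by rewrite /h; lra.
rewrite -{1}(gtr0_norm h0) !lt_min => /andP[/hr h1 /andP[/hs h2 /ht h3]].
have hn : 0 < `|h| by rewrite gtr0_norm.
rewrite -(ler_pM2r hn) -normrM.
have -> : (l - m) * h = (v (sh b y h) - v y - (w (sh b z h) - w z)) -
  ((v (sh b y h) - v y - l * h) - (w (sh b z h) - w z - m * h)) by ring.
apply: (le_trans (ler_normB _ _)).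
have := ler_normB (v (sh b y h) - v y - l * h) (w (sh b z h) - w z - m * h).
lra.
Qed.

(** The mean value theorem for [F] reduces the claim to the first-order expansion of [f1] at the
    single point [a], used at [c] and [- c]. *)
Lemma second_difference (f f1 : R -> R) (a l r : R) : 0 < r ->
  (forall t, `|t - a| < r -> is_derive t 1 f (f1 t)) ->
  derivable f1 a 1 -> derive1 f1 a = l ->
  forall e, 0 < e -> exists2 r, 0 < r & forall s, 0 < s -> s < r ->
    `|f (a + s) + f (a - s) - 2 * f a - l * s ^+ 2| <= e * s ^+ 2.
Proof.
move=> r0 hf df1 f1l e e0; have e2 : 0 < e / 2 by lra.
have [r' r'0 hr'] := (derive1_smallo f1 a l).1 (conj df1 f1l) _ e2.
exists (Num.min r r'); first by rewrite lt_min r0.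
move=> s s0; rewrite lt_min => /andP[sr sr'].
pose F t := f (t + a) + f (- t + a) - l * (t * t).
pose F1 t := f1 (t + a) - f1 (- t + a) - 2 * l * t.
have dF t : 0 <= t <= s -> is_derive t 1 F (F1 t).
  move=> /andP[t0 ts].
  have i1 : is_derive (t + a) 1 f (f1 (t + a)).
    by apply: hf; rewrite addrK ger0_norm //; lra.
  have i2 : is_derive (- t + a) 1 f (f1 (- t + a)).
    by apply: hf; rewrite addrK normrN ger0_norm //; lra.
  have j1 : is_derive t 1 (fun t => f (t + a)) (f1 (t + a) * (1 + 0)).
    exact: is_derive1_comp.
  have j2 : is_derive t 1 (fun t => f (- t + a)) (f1 (- t + a) * (- 1 + 0)).
    exact: is_derive1_comp.
  have j3 : is_derive t 1 (fun t => l * (t * t)) (l * (t * 1 + t * 1)).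
    have j4 : is_derive t 1 (fun t : R => t * t) (t *: (1 : R) + t *: (1 : R)).
      exact: (@is_deriveM R R id id t 1 1 1).
    exact: (is_deriveZ l j4).
  have j12 := is_deriveB (is_deriveD j1 j2) j3.
  apply: (@is_derive_eq _ _ _ F t 1 (F1 t) _ j12).
  by rewrite /F1; ring.
have [||c] := @MVT_segment R F F1 0 s (ltW s0).
- by move=> t; rewrite in_itv /= => /andP[t0 ts]; apply: dF; rewrite !ltW.
- apply: derivable_within_continuous => t; rewrite in_itv /= => /dF h.
  exact: ex_derive.
rewrite in_itv /= => /andP[c0 cs]; rewrite subr0 => E.
have c1 : `|c| < r' by rewrite ger0_norm //; lra.
have c2 : `|- c| < r' by rewrite normrN.
have := hr' _ c1; have := hr' _ c2; rewrite normrN (ger0_norm c0) => g1 g2.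
have -> : f (a + s) + f (a - s) - 2 * f a - l * s ^+ 2 = F s - F 0.
  by rewrite /F oppr0 !add0r mulr0 [s + a]addrC [- s + a]addrC; ring.
rewrite E normrM (gtr0_norm s0) expr2 mulrA ler_pM2r //.
apply: (@le_trans _ _ (e * c)); last by rewrite ler_pM2l.
rewrite /F1 [c + a]addrC [- c + a]addrC; abslra.
Qed.

Lemma harmonic_wharmonic (D : set P) u : open D -> harmonic_on D u -> wharmonic D u.
Proof.
move=> oD [[C1u [C11 C12]] lap] x Dx; split.
  by case: C1u => cu _; apply: cu; apply/mem_set.
have [r r0 hr] := (open_sqP _).1 oD _ Dx.
have h1 t : `|t - x.1| < r -> is_derive t 1 (fun t => u (t, x.2)) (partial1 u (t, x.2)).
  move=> ht; have /C1u.2.1 [h _] : D (t, x.2) by apply: hr; split => //=; rewrite subrr normr0.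
  by apply: DeriveDef => //; rewrite /partial1 /= derive1E.
have h2 t : `|t - x.2| < r -> is_derive t 1 (fun t => u (x.1, t)) (partial2 u (x.1, t)).
  move=> ht; have /C1u.2.1 [_ h] : D (x.1, t) by apply: hr; split => //=; rewrite subrr normr0.
  by apply: DeriveDef => //; rewrite /partial2 /= derive1E.
move=> e e0; have e2 : 0 < e / 2 by lra.
have [g1 _] := C11.2.1 _ Dx; have [_ g2] := C12.2.1 _ Dx.
have := lap _ Dx; rewrite /laplacian.
set p1 := partial1 (partial1 u) x; set p2 := partial2 (partial2 u) x => L.
have [s s0 hs] := second_difference (l := p1) r0 h1 g1 erefl e2.
have [t t0 ht] := second_difference (l := p2) r0 h2 g2 erefl e2.
exists (Num.min s t); first by rewrite lt_min s0.
move=> k k0; rewrite lt_min => /andP[/(hs _ k0) a1 /(ht _ k0) a2].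
rewrite /cross.
clearbody p1 p2.
have -> : u (x.1 + k, x.2) + u (x.1 - k, x.2) + u (x.1, x.2 + k) +
   u (x.1, x.2 - k) - 4 * u x - 0 * k ^+ 2 =
  (u (x.1 + k, x.2) + u (x.1 - k, x.2) - 2 * u (x.1, x.2) -
     p1 * k ^+ 2) +
  (u (x.1, x.2 + k) + u (x.1, x.2 - k) - 2 * u (x.1, x.2) -
     p2 * k ^+ 2).
  have -> : p2 = - p1 by lra.
  by rewrite -surjective_pairing; ring.
apply: (le_trans (ler_normD _ _)); lra.
Qed.

End Partials.

(** * Locally uniform limits of harmonic functions are harmonic *)

Section LocallyUniformLimits.
Context {R : realType}.
Local Notation P := (R * R)%type.
Implicit Types (u w : P -> R) (us ws : nat -> P -> R) (x : P) (D : set P).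

Definition locunif D ws w : Prop := forall x, D x ->
  exists2 r, 0 < r & sq x r `<=` D /\ forall e, 0 < e -> exists N, forall n z,
    (N <= n)%N -> sq x r z -> `|ws n z - w z| <= e.

(** Locally, [ws n - w] has Lipschitz constant tending to 0 along axis [b]: convergence of
    derivatives, phrased without assuming that [w] has any. *)
Definition loclip (b : bool) D ws w : Prop := forall x, D x ->
  exists2 r, 0 < r & sq x r `<=` D /\ forall e, 0 < e -> exists N, forall n z h,
    (N <= n)%N -> sq x r z -> sq x r (sh b z h) ->
    `|ws n (sh b z h) - w (sh b z h) - (ws n z - w z)| <= e * `|h|.

Lemma real_cauchy (l_ : nat -> R) :
  (forall e, 0 < e -> exists N, forall n m, (N <= n)%N -> (N <= m)%N ->
    `|l_ n - l_ m| <= e) ->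
  exists l, forall e, 0 < e -> exists N, forall n, (N <= n)%N -> `|l_ n - l| <= e.
Proof.
move=> h.
have : cauchy (l_ n @[n --> \oo]).
  apply: cauchy_exP => e e0; have [|N hN] := h (e / 2); first by lra.
  exists (l_ N); exists N => // n /= Nn.
  have := hN _ _ (leqnn N) Nn; rewrite -ball_normE /=; lra.
move=> /R_complete /cvg_ex [l /cvgrPdist_le hl]; exists l => e /hl [N _ hN].
by exists N => n Nn; rewrite distrC; exact: hN.
Qed.

Lemma sq_sh b x r z : 0 < r -> sq x r z ->
  exists2 s, 0 < s & forall h, `|h| < s -> sq x r (sh b z h).
Proof.
move=> r0 hz; have [s s0 hs] := (open_sqP _).1 (@open_sq R x r) _ hz.
exists s => // h hh; apply: hs; rewrite /sh.
by case: b; split=> /=; rewrite ?subrr ?normr0 // addrC addKr.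
Qed.

(** The derivatives at a point form a Cauchy sequence, and its limit is the derivative of [w] by a
    three-term estimate. The Lipschitz bound on [ws n - w] then bounds the difference of the
    derivatives uniformly. *)
Lemma loclip_pd b D ws w : loclip b D ws w ->
  (forall n x, D x -> has_pd b (ws n) x) ->
  (forall x, D x -> has_pd b w x) /\ locunif D (fun n => pd b (ws n)) (pd b w).
Proof.
move=> hl hd.
have hw x : D x -> has_pd b w x.
  move=> Dx; have [r r0 [sD hr]] := hl _ Dx.
  have xin := sq_center x r0.
  have [s s0 hs] := sq_sh b r0 xin.
  have cl n := pdlim_pd (hd n _ Dx).
  have [|l hl'] := @real_cauchy (fun n => pd b (ws n) x).
    move=> e e0; have [|N hN] := hr (e / 2); first by lra.
    exists N => n m Nn Nm; apply: (pdlim_dist_le (cl n) (cl m)).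
    exists s => // h /hs hh.
    have := hN _ _ _ Nn xin hh; have := hN _ _ _ Nm xin hh => a1 a2.
    have -> : ws n (sh b x h) - ws n x - (ws m (sh b x h) - ws m x) =
      ws n (sh b x h) - w (sh b x h) - (ws n x - w x) -
      (ws m (sh b x h) - w (sh b x h) - (ws m x - w x)) by ring.
    apply: (le_trans (ler_normB _ _)); lra.
  suff : pdlim b w x l by move=> /pdP [].
  move=> e e0; have e3 : 0 < e / 3 by lra.
  have [N1 hN1] := hr _ e3; have [N2 hN2] := hl' _ e3.
  pose n := maxn N1 N2.
  have n2 := hN2 n (leq_maxr _ _).
  have [t t0 ht] := cl n _ e3.
  exists (Num.min s t); first by rewrite lt_min s0.
  move=> h; rewrite lt_min => /andP[/hs hh /ht a2].
  have a1 := hN1 n _ _ (leq_maxl _ _) xin hh.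
  have -> : w (sh b x h) - w x - l * h =
    (ws n (sh b x h) - ws n x - pd b (ws n) x * h) -
    (ws n (sh b x h) - w (sh b x h) - (ws n x - w x)) +
    (pd b (ws n) x - l) * h by ring.
  apply: (le_trans (ler_normD _ _)); rewrite normrM.
  have a3 := ler_wpM2r (normr_ge0 h) n2.
  have := ler_normB (ws n (sh b x h) - ws n x - pd b (ws n) x * h)
    (ws n (sh b x h) - w (sh b x h) - (ws n x - w x)).
  lra.
split => // x Dx; have [r r0 [sD hr]] := hl _ Dx; exists r => //; split => //.
move=> e /hr [N hN]; exists N => n z Nn hz.
apply: (pdlim_dist_le (pdlim_pd (hd n _ (sD _ hz))) (pdlim_pd (hw _ (sD _ hz)))).
have [s s0 hs] := sq_sh b r0 hz; exists s => // h /hs hh.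
have -> : ws n (sh b z h) - ws n z - (w (sh b z h) - w z) =
  ws n (sh b z h) - w (sh b z h) - (ws n z - w z) by ring.
exact: hN.
Qed.

Lemma locunif_continuous D ws w : locunif D ws w ->
  (forall n x, D x -> {for x, continuous (ws n)}) ->
  forall x, D x -> {for x, continuous w}.
Proof.
move=> hl hc x Dx; apply/continuous_sqP => e e0; have e3 : 0 < e / 3 by lra.
have [r r0 [sD hr]] := hl _ Dx; have [N hN] := hr _ e3.
have /continuous_sqP /(_ _ e3) [s s0 hs] := hc N _ Dx.
exists (Num.min r s); first by rewrite lt_min r0.
move=> z [z1 z2]; move: z1 z2; rewrite !lt_min => /andP[z1 z1'] /andP[z2 z2'].
have a1 := hN N z (leqnn _) (conj z1 z2).
have a2 := hN N x (leqnn _) (sq_center x r0).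
have a3 := hs z (conj z1' z2').
abslra.
Qed.

Lemma C1_onP D u : C1_on D u <-> (forall x, D x -> {for x, continuous u}) /\
  (forall b x, D x -> has_pd b u x) /\
  (forall b x, D x -> {for x, continuous (pd b u)}).
Proof.
split=> [[cu [du [c1 c2]]]|[cu [du dc]]].
  split; first by move=> x /mem_set /cu.
  by split=> b x Dx; case: b; [case: (du _ Dx)|case: (du _ Dx)|apply: c1|apply: c2] => //;
    apply/mem_set.
split; first by move=> x /set_mem /cu.
split; first by move=> x Dx; split; [apply: (du true)|apply: (du false)].
by split=> x /set_mem Dx; [apply: (dc true)|apply: (dc false)].
Qed.

Lemma locunif_C1 D ws w : (forall n, C1_on D (ws n)) -> locunif D ws w ->
  (forall b, loclip b D ws w) ->
  C1_on D w /\ forall b, locunif D (fun n => pd b (ws n)) (pd b w).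
Proof.
move=> hC hw hl.
have hd b n x : D x -> has_pd b (ws n) x by case: ((C1_onP _ _).1 (hC n)) => _ [h _]; apply: h.
have lu b := (loclip_pd (hl b) (hd b)).2.
split => //; apply/C1_onP; split.
  by apply: locunif_continuous hw _ => n; case: ((C1_onP _ _).1 (hC n)).
split; first by move=> b; case: (loclip_pd (hl b) (hd b)).
move=> b; apply: locunif_continuous (lu b) _ => n.
by case: ((C1_onP _ _).1 (hC n)) => _ [_]; apply.
Qed.

Lemma wharmonic_loclip b D us u : (forall n, wharmonic D (us n)) -> locunif D us u ->
  loclip b D us u.
Proof.
move=> hu hl x Dx; have [r r0 [sD hr]] := hl _ Dx.
have sub : sq x (r / 2) `<=` sq x r by apply: subsq; rewrite subrr normr0; lra.
exists (r / 2); first by lra.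
split; first exact: subset_trans sD.
(* Two terms within [e * r / 8] of the limit differ by at most [e * r / 4], for which [lipschitz_le]
   yields slope exactly [e]. *)
move=> e e0; have e'0 : 0 < e * r / 8 by rewrite divr_gt0 // mulr_gt0.
have [N hN] := hr _ e'0; exists N => n z h Nn hz hz'.
(* The limit [u] is not yet known to be harmonic, so the estimate is made on [us n - us m] with [m]
   so large that replacing [us m] by [u] costs at most [d]. *)
apply/ler_addgt0Pr => d d0; have d2 : 0 < d / 2 by lra.
have [N' hN'] := hr _ d2; pose m := maxn N N'.
have bound y : sq x r y -> `|us n y - us m y| <= e * r / 4.
  move=> hy; have := hN n _ Nn hy; have := hN m _ (leq_maxl _ _) hy => a1 a2.
  by abslra.
have := lipschitz_le r0 (sub_wharmonic sD (wharmonicB (hu n) (hu m))) bound hz hz'.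
have -> : 4 * (e * r / 4) / r = e by field; rewrite gt_eqF.
have := hN' m _ (leq_maxr _ _) (sub _ hz); have := hN' m _ (leq_maxr _ _) (sub _ hz').
move=> a1 a2 a3.
have -> : us n (sh b z h) - u (sh b z h) - (us n z - u z) =
  (us n (sh b z h) - us m (sh b z h) - (us n z - us m z)) +
  ((us m (sh b z h) - u (sh b z h)) - (us m z - u z)) by ring.
apply: (le_trans (ler_normD _ _)).
have := ler_normB (us m (sh b z h) - u (sh b z h)) (us m z - u z); lra.
Qed.

(** The same argument one order higher: dividing [double_difference_le] by [h] and letting [h] tend
    to 0 gives a Lipschitz bound for the derivative of [us n - us m]. *)
Lemma wharmonic_loclip_pd b c D us u : (forall n, wharmonic D (us n)) ->
  (forall n x, D x -> has_pd c (us n) x) -> locunif D us u ->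
  locunif D (fun n => pd c (us n)) (pd c u) ->
  loclip b D (fun n => pd c (us n)) (pd c u).
Proof.
move=> hu hd hl hl' x Dx; have [r r0 [sD hr]] := hl _ Dx.
have [r' r'0 [_ hr']] := hl' _ Dx.
pose p := Num.min (r / 8) r'.
have p8 : p <= r / 8 by rewrite /p ge_min lexx.
have pr' : p <= r' by rewrite /p ge_min lexx orbT.
have p0 : 0 < p by rewrite /p lt_min r'0 andbT; lra.
have sub8 : sq x p `<=` sq x (r / 8) by apply: subsq; rewrite subrr normr0; lra.
have sub1 : sq x p `<=` sq x r by apply: subsq; rewrite subrr normr0; lra.
have sub' : sq x p `<=` sq x r' by apply: subsq; rewrite subrr normr0; lra.
exists p => //; split; first exact: subset_trans sD.
move=> e e0; have e'0 : 0 < e * r ^+ 2 / 128 by rewrite divr_gt0 // mulr_gt0 // exprn_gt0.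
have [N hN] := hr _ e'0; exists N => n z t Nn hz hz'.
apply/ler_addgt0Pr => d d0; have d2 : 0 < d / 2 by lra.
have [N' hN'] := hr' _ d2; pose m := maxn N N'.
have bound y : sq x r y -> `|us n y - us m y| <= e * r ^+ 2 / 64.
  move=> hy; have := hN n _ Nn hy; have := hN m _ (leq_maxl _ _) hy => a1 a2.
  by abslra.
have lim y : sq x p y -> pdlim c (fun y => us n y - us m y) y (pd c (us n) y - pd c (us m) y).
  by move=> /sub1 /sD Dy; apply: pdlimB; apply: pdlim_pd; apply: hd.
have a3 : `|pd c (us n) (sh b z t) - pd c (us m) (sh b z t)
           - (pd c (us n) z - pd c (us m) z)| <= e * `|t|.
  apply: (pdlim_dist_le (lim _ hz') (lim _ hz)); exists (r / 4); first by lra.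
  move=> h hh.
  have := double_difference_le c r0 (sub_wharmonic sD (wharmonicB (hu n) (hu m)))
    bound hh (sub8 _ hz) (sub8 _ hz').
  have -> : 64 * (e * r ^+ 2 / 64) / r ^+ 2 = e.
    by field; rewrite gt_eqF.
  by rewrite mulrAC.
have := hN' m _ (leq_maxr _ _) (sub' _ hz); have := hN' m _ (leq_maxr _ _) (sub' _ hz').
move=> a1 a2.
have -> : pd c (us n) (sh b z t) - pd c u (sh b z t) - (pd c (us n) z - pd c u z) =
  (pd c (us n) (sh b z t) - pd c (us m) (sh b z t) - (pd c (us n) z - pd c (us m) z)) +
  ((pd c (us m) (sh b z t) - pd c u (sh b z t)) - (pd c (us m) z - pd c u z)) by ring.
apply: (le_trans (ler_normD _ _)).
have := ler_normB (pd c (us m) (sh b z t) - pd c u (sh b z t)) (pd c (us m) z - pd c u z); lra.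
Qed.

(** Two rounds of [locunif_C1] give locally uniform convergence of the second derivatives, so the
    equation passes to the limit. *)
Lemma harmonic_locunif D us u : open D -> (forall n, harmonic_on D (us n)) ->
  locunif D us u -> harmonic_on D u.
Proof.
move=> oD hu hl.
have wu n := harmonic_wharmonic oD (hu n).
have C1u n : C1_on D (us n) by case: (hu n) => [[]].
have C1pd c n : C1_on D (pd c (us n)).
  by case: c; [exact: (hu n).1.2.1|exact: (hu n).1.2.2].
have hd c n x : D x -> has_pd c (us n) x.
  by case: ((C1_onP _ _).1 (C1u n)) => _ [h _]; apply: h.
have [C1 lu1] := locunif_C1 C1u hl (fun b => wharmonic_loclip b wu hl).
have C2 c := locunif_C1 (C1pd c) (lu1 c)
  (fun b => wharmonic_loclip_pd b wu (hd c) hl (lu1 c)).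
split; first by split => //; split; [exact: (C2 true).1|exact: (C2 false).1].
move=> x Dx.
apply/eqP; rewrite -normr_le0; apply/ler_addgt0Pr => e e0; rewrite add0r.
have e2 : 0 < e / 2 by lra.
have [r1 r10 [_ /(_ _ e2) [N1 h1]]] := (C2 true).2 true _ Dx.
have [r2 r20 [_ /(_ _ e2) [N2 h2]]] := (C2 false).2 false _ Dx.
pose n := maxn N1 N2.
have := h1 n x (leq_maxl _ _) (sq_center x r10).
have := h2 n x (leq_maxr _ _) (sq_center x r20).
have : pd true (pd true (us n)) x + pd false (pd false (us n)) x = 0 := (hu n).2 _ Dx.
have -> : laplacian u x = pd true (pd true u) x + pd false (pd false u) x by [].
move: (pd true (pd true (us n)) x) (pd false (pd false (us n)) x)
  (pd true (pd true u) x) (pd false (pd false u) x) => p1 p2 q1 q2 a1 a2 a3.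
abslra.
Qed.

End LocallyUniformLimits.

(** * Comparison of Dirichlet solutions and the Daniell upper integral *)

Section DirichletIntegral.
Context {R : realType}.
Local Notation P := (R * R)%type.
Context (D : set P) (openD : open D)
  (boundedD : exists M : R, forall x, D x -> `|x.1| <= M /\ `|x.2| <= M).

Lemma compact_closure_bounded : compact (closure D).
Proof.
have [M hM] := boundedD.
apply: (@subclosed_compact _ _ (csq (0, 0) M)); first exact: closed_closure.
  exact: compact_csq.
have cc : closed (csq ((0, 0) : P) M).
  by apply: compact_closed; [exact: norm_hausdorff|exact: compact_csq].
rewrite [X in _ `<=` X]((closure_id _).1 cc); apply: closure_subset => x /hM [h1 h2].
by split; rewrite subr0.
Qed.

Lemma compact_bdry : compact (bdry D).
Proof.
apply: subclosed_compact compact_closure_bounded _; last by move=> x [].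
by apply: closedI; [exact: closed_closure|exact: open_closedC].
Qed.

Lemma wharmonic_le_bdry (w : P -> R) (m : R) : wharmonic D w ->
  {within closure D, continuous w} -> (forall y, bdry D y -> w y <= m) ->
  forall y, D y -> w y <= m.
Proof.
move=> hw cw hm y Dy.
apply: (max_principle compact_closure_bounded cw); last exact: subset_closure.
move=> x cx; have [Dx|nDx] := pselect (D x); last by left; apply: hm.
right; split.
  have [r r0 hr] := (open_sqP _).1 openD _ Dx; exists r => // z /hr.
  exact: subset_closure.
by exists 0 => //; case: (hw _ Dx).
Qed.

Context (U : (P -> R) -> P -> R) (hU : forall g, Cbd D g -> dirichlet_sol D g (U g)).

Lemma wharmonic_sol g : Cbd D g -> wharmonic D (U g).
Proof. by move=> /hU [h _]; exact: harmonic_wharmonic. Qed.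

Lemma sol_le g g' : Cbd D g -> Cbd D g' -> (forall y, bdry D y -> g y <= g' y) ->
  forall y, D y -> U g y <= U g' y.
Proof.
move=> cg cg' h y Dy; rewrite -subr_le0.
have [_ [c1 b1]] := hU cg; have [_ [c2 b2]] := hU cg'.
apply: (@wharmonic_le_bdry (fun z => U g z - U g' z)) => //.
- by apply: wharmonicB; exact: wharmonic_sol.
- exact: within_continuousB.
by move=> z bz; rewrite b1 // b2 // subr_le0; exact: h.
Qed.

Lemma solD_ge g g' (c : R) : Cbd D g -> Cbd D g' ->
  (forall y, bdry D y -> - c <= g y + g' y) ->
  forall y, D y -> - c <= U g y + U g' y.
Proof.
move=> cg cg' h y Dy.
have [_ [c1 b1]] := hU cg; have [_ [c2 b2]] := hU cg'.
suff : - U g y - U g' y <= c by lra.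
apply: (@wharmonic_le_bdry (fun z => - U g z - U g' z)) => //.
- by apply: wharmonicB; [apply: wharmonicN|]; exact: wharmonic_sol.
- apply: within_continuousB => //.
  have -> : (fun z => - U g z) = (cst 0 - U g)%R by apply/funext => z /=; rewrite sub0r.
  apply: within_continuousB => //; exact: cst_continuous.
by move=> z bz; rewrite b1 // b2 //; have := h _ bz; lra.
Qed.

(** These are the competitors in the infimum defining [upper_int], with the limit [phi] hidden
    because later arguments handle only the sequence. *)
Definition admissible (g : nat -> P -> R) (f : P -> \bar R) : Prop :=
  incr_seq D g /\ exists phi : P -> \bar R,
    (forall y, bdry D y -> (fun n => (g n y)%:E) @ \oo --> phi y) /\
    (forall y, bdry D y -> (f y <= phi y)%E).

Lemma incr_seq_le g y : incr_seq D g -> bdry D y ->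
  {homo (fun n => g n y) : n m / (n <= m)%N >-> n <= m}.
Proof. by move=> [_ h] by_; apply/nondecreasing_seqP => n; exact: h. Qed.

Lemma sol_incr g y : incr_seq D g -> D y ->
  {homo (fun n => U (g n) y) : n m / (n <= m)%N >-> n <= m}.
Proof.
move=> [cg h] Dy; apply/nondecreasing_seqP => n.
by apply: sol_le => // z; exact: h.
Qed.

Lemma near_gt_EFin (s : nat -> R) (l : \bar R) (a : R) :
  (fun n => (s n)%:E) @ \oo --> l -> (a%:E < l)%E ->
  exists N, forall n, (N <= n)%N -> a < s n.
Proof.
move=> cs al.
have : nbhs l [set z | (a%:E < z)%E].
  by apply: open_nbhs_nbhs; split => //; exact: open_ereal_gt_ereal.
by move=> /cs [N _ hN]; exists N => n /hN; rewrite /= lte_fin.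
Qed.

(** The limits majorize [f y] and [- f y]. If [f y] is infinite, one sequence exceeds every level
    while the other stays above its first term, so no undefined sum arises. *)
Lemma admissible_pair_pointwise g g' f (e : R) y : 0 < e -> admissible g f ->
  admissible g' (fun z => - f z)%E -> bdry D y -> exists N, - e < g N y + g' N y.
Proof.
move=> e0 [ig [phi [cg hf]]] [ig' [phi' [cg' hf']]] by_.
suff [a [b [ab [N hN] [N' hN']]]] : exists a b : R, [/\ - e < a + b,
    exists N, forall n, (N <= n)%N -> a < g n y &
    exists N, forall n, (N <= n)%N -> b < g' n y].
  exists (maxn N N').
  have := hN _ (leq_maxl N N'); have := hN' _ (leq_maxr N N'); lra.
have := hf' _ by_; have := hf _ by_; have := cg' _ by_; have := cg _ by_.
have lowb (h : nat -> P -> R) : incr_seq D h -> forall n, (0 <= n)%N -> h 0%N y - 1 < h n y.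
  by move=> ih n n0; have := incr_seq_le ih by_ n0; lra.
case: (f y) => [r| |] c1 c2 h1 h2.
- exists (r - e / 3), (- r - e / 3); split; first by lra.
    by apply: near_gt_EFin c1 _; apply: lt_le_trans h1; rewrite lte_fin; lra.
  by apply: near_gt_EFin c2 _; apply: lt_le_trans h2; rewrite lte_fin; lra.
- exists (- (g' 0%N y - 1)), (g' 0%N y - 1); split; first by lra.
    by apply: near_gt_EFin c1 _; apply: lt_le_trans h1; exact: ltry.
  by exists 0%N; exact: lowb.
- exists (g 0%N y - 1), (- (g 0%N y - 1)); split; first by lra.
    by exists 0%N; exact: lowb.
  by apply: near_gt_EFin c2 _; apply: lt_le_trans h2; exact: ltry.
Qed.

(** Dini's argument: by continuity the pointwise inequality holds near each boundary point, by
    monotonicity it persists for larger indices, and compactness yields one index. *)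
Lemma admissible_pair_uniform g g' f (e : R) : 0 < e -> admissible g f ->
  admissible g' (fun z => - f z)%E ->
  exists N, forall y, bdry D y -> - e <= g N y + g' N y.
Proof.
move=> e0 ag ag'.
have [ig _] := ag; have [ig' _] := ag'.
have := (compact_near_coveringP (bdry D)).1 compact_bdry nat \oo
  (fun n y => bdry D y -> - e < g n y + g' n y) _.
case.
  move=> y by_; have [N hN] := admissible_pair_pointwise e0 ag ag' by_.
  (* [d] is half the slack at [y]; each function may drop by [d / 2], which still leaves slack
     [d]. *)
  pose d := (g N y + g' N y + e) / 2.
  have d0 : 0 < d / 2 by rewrite /d; lra.
  have [r1 r10 h1] := (within_continuousP _ _).1 (ig.1 N) _ by_ _ d0.
  have [r2 r20 h2] := (within_continuousP _ _).1 (ig'.1 N) _ by_ _ d0.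
  exists (sq y (Num.min r1 r2), [set n | (N <= n)%N]).
    split; last by exists N.
    by apply/nbhs_sqP; exists (Num.min r1 r2) => //; rewrite lt_min r10.
  move=> [z n] /= [[z1 z2] Nn] bz.
  move: z1 z2; rewrite !lt_min => /andP[z1 z1'] /andP[z2 z2'].
  have := h1 z (conj z1 z2) bz; have := h2 z (conj z1' z2') bz.
  have := incr_seq_le ig bz Nn; have := incr_seq_le ig' bz Nn.
  rewrite /d /= => a1 a2 a3 a4; unabs; lra.
by move=> N _ hN; exists N => y by_; apply: ltW; apply: (hN N) => //=.
Qed.

Lemma sol_lim g y : incr_seq D g -> D y ->
  limn (fun n => (U (g n) y)%:E) = ereal_sup (range (fun n => (U (g n) y)%:E)).
Proof.
move=> ig Dy; apply/cvg_lim => //; apply: ereal_nondecreasing_cvgn.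
by move=> n m nm; rewrite lee_fin; exact: sol_incr.
Qed.

Lemma upper_int_le g f y (a : R) : admissible g f -> D y ->
  (forall n, U (g n) y <= a) -> (upper_int D (fun g => U g y) f <= a%:E)%E.
Proof.
move=> [ig [phi [cg hf]]] Dy ha.
apply: (@le_trans _ _ (limn (fun n => (U (g n) y)%:E))).
  by apply: ereal_inf_lbound; exists g, phi.
by rewrite sol_lim //; apply: ge_ereal_sup => _ [n _ <-]; rewrite lee_fin.
Qed.

(** Every competitor for [f] is paired with the fixed [g']: on the boundary their sum is eventually
    above [- e], hence so is the sum of the solutions at [y]. *)
Lemma upper_int_ge g' f y (a : R) : admissible g' (fun z => - f z)%E -> D y ->
  (forall n, U (g' n) y <= a) -> ((- a)%:E <= upper_int D (fun g => U g y) f)%E.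
Proof.
move=> ag' Dy ha; apply: le_ereal_inf_tmp => _ [g [phi [ig cg hf ->]]].
have ag : admissible g f by split => //; exists phi.
apply/lee_addgt0Pr => e e0.
have [N hN] := admissible_pair_uniform e0 ag ag'.
have := solD_ge (ig.1 N) (ag'.1.1 N) hN Dy; have := ha N => h1 h2.
rewrite sol_lim // -leeBlDr //.
apply: (@le_trans _ _ (U (g N) y)%:E).
  by rewrite -EFinB lee_fin; lra.
by apply: ereal_sup_ubound; exists N.
Qed.

Lemma upper_int_admissible f y (r e : R) : D y ->
  upper_int D (fun g => U g y) f = r%:E -> 0 < e ->
  exists2 g, admissible g f & forall n, U (g n) y <= r + e.
Proof.
move=> Dy hr e0.
have : (upper_int D (fun g => U g y) f < (r + e)%:E)%E by rewrite hr lte_fin; lra.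
move=> /ereal_inf_lt [_ [g [phi [ig cg hf ->]]]].
rewrite sol_lim // => h; exists g; first by split => //; exists phi.
move=> n; rewrite -lee_fin; apply: le_trans (ltW h).
by apply: ereal_sup_ubound; exists n.
Qed.

Context (connD : connected D) (x : P) (Dx : D x).

(* Harnack's inequality applied to the differences [U (g m) - U (g n)], which are
   nonnegative for [n <= m], turns convergence at [x] into convergence on [D]. *)
Lemma harmonic_sup g f (c : R) : admissible g f -> (forall n, U (g n) x <= c) ->
  exists a : P -> R, [/\ harmonic_on D a, a x <= c &
    forall y, D y -> forall n, U (g n) y <= a y].
Proof.
move=> [ig _] hc.
pose S y := range (fun n => U (g n) y).
have S0 y : S y !=set0 by exists (U (g 0%N) y), 0%N.
have ubx : ubound (S x) c by move=> _ [n _ <-].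
have supx : has_sup (S x) by split => //; exists c.
pose a y := sup (S y).
have diff n m : (n <= m)%N -> wharmonic D (fun z => U (g m) z - U (g n) z) /\
    forall z, D z -> 0 <= U (g m) z - U (g n) z.
  move=> nm; split; last by move=> z Dz; rewrite subr_ge0; exact: sol_incr.
  by apply: wharmonicB; apply: wharmonic_sol; case: ig.
have xcvg e : 0 < e -> exists N, forall n m, (N <= n)%N -> (n <= m)%N ->
    U (g m) x - U (g n) x <= e.
  move=> e0; have [_ [N _ <-] hN] := sup_adherent e0 supx.
  exists N => n m Nn nm; have := sol_incr ig Dx Nn.
  have : U (g m) x <= sup (S x) by apply: sup_upper_bound => //; exists m.
  move: hN; lra.
have unif y : D y -> exists2 r, 0 < r & sq y r `<=` D /\ forall e, 0 < e ->
    exists N, forall n z k, (N <= n)%N -> sq y r z -> U (g k) z <= U (g n) z + e.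
  move=> Dy; have [C [r [C0 r0 sD hC]]] := harnack openD connD Dx Dy.
  exists r => //; split => // e e0.
  (* [C + 1] is the divisor because the Harnack constant may be 0. *)
  have [|N hN] := xcvg (e / (C + 1)); first by rewrite divr_gt0 //; lra.
  exists N => n z k Nn hz.
  have [kn|nk] := leqP k n.
    by apply: (le_trans (sol_incr ig (sD _ hz) kn)); rewrite lerDl ltW.
  have [h1 h2] := diff _ _ (ltnW nk).
  have := hC _ h1 h2 _ hz; have := hN _ _ Nn (ltnW nk) => h3 h4.
  have : C * (U (g k) x - U (g n) x) <= C * (e / (C + 1)) by apply: ler_wpM2l.
  have : C * (e / (C + 1)) <= e.
    by rewrite mulrA ler_pdivrMr; [rewrite mulrC ler_pM2l //|]; lra.
  lra.
have hs y : D y -> has_sup (S y).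
  move=> Dy; have [r r0 [sD hr]] := unif _ Dy; split => //.
  have [N hN] := hr 1 ltr01; exists (U (g N) y + 1) => _ [k _ <-].
  by apply: hN => //; exact: sq_center.
have aub y n : D y -> U (g n) y <= a y.
  by move=> /hs h; apply: sup_upper_bound => //; exists n.
have lu : locunif D (fun n => U (g n)) a.
  move=> y Dy; have [r r0 [sD hr]] := unif _ Dy; exists r => //; split => //.
  move=> e /hr [N hN]; exists N => n z Nn hz.
  have : a z <= U (g n) z + e.
    by apply: ge_sup => // _ [k _ <-]; exact: hN.
  have := aub _ n (sD _ hz) => h1 h2; abslra.
exists a; split.
- apply: harmonic_locunif lu => // n.
  by case: (hU (ig.1 n)).
- exact: ge_sup.
by move=> y Dy n; exact: aub.
Qed.

Lemma admissible_pair_sup_ge0 g g' f (a a' : P -> R) y : admissible g f ->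
  admissible g' (fun z => - f z)%E -> D y ->
  (forall n, U (g n) y <= a y) -> (forall n, U (g' n) y <= a' y) -> 0 <= a y + a' y.
Proof.
move=> ag ag' Dy ha ha'; apply/ler_addgt0Pr => e e0.
have [N hN] := admissible_pair_uniform e0 ag ag'.
have := solD_ge (ag.1.1 N) (ag'.1.1 N) hN Dy.
have := ha N; have := ha' N; lra.
Qed.

Lemma integrable_transfer f : integrable_D D (fun g => U g x) f ->
  (forall y, D y -> integrable_D D (fun g => U g y) f) /\
  harmonic_on D (fun y => daniell D (fun g => U g y) f).
Proof.
move=> [r [hup hlow]].
have hup' : upper_int D (fun g => U g x) (fun z => - f z)%E = (- r)%:E.
  by move: hlow; rewrite /lower_int EFinN => <-; rewrite oppeK.
(* Each [e] gives two brackets, for the upper integrals of [f] and of [- f], sharing the gap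
   [a + a']. The gap is nonnegative and harmonic, so its value at [x] controls it throughout [D]. *)
have step e : 0 < e -> exists a a' : P -> R, [/\ harmonic_on D a,
    wharmonic D (fun z => a z + a' z), a x + a' x <= e &
    forall y, D y -> [/\ 0 <= a y + a' y,
      ((- a' y)%:E <= upper_int D (fun g => U g y) f <= (a y)%:E)%E &
      ((- a y)%:E <= upper_int D (fun g => U g y) (fun z => - f z)%E <= (a' y)%:E)%E]].
  move=> e0; have e2 : 0 < e / 2 by lra.
  have [g ag hg] := upper_int_admissible Dx hup e2.
  have [g' ag' hg'] := upper_int_admissible Dx hup' e2.
  have [a [Ha ax hA]] := harmonic_sup ag hg.
  have [a' [Ha' ax' hA']] := harmonic_sup ag' hg'.
  exists a, a'; split => //; last 2 first.
  - by lra.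
  - move=> y Dy; have b1 := hA _ Dy; have b2 := hA' _ Dy; split.
    + exact: (admissible_pair_sup_ge0 ag ag' Dy).
    + apply/andP; split; first exact: upper_int_ge ag' Dy b2.
      exact: upper_int_le ag Dy b1.
    + apply/andP; split; last exact: upper_int_le ag' Dy b2.
      apply: upper_int_ge Dy b1.
      have -> : (fun z => - (- f z))%E = f by apply/funext => z; rewrite oppeK.
      exact: ag.
  by apply: wharmonicD; exact: harmonic_wharmonic.
pose e_ (n : nat) : R := n.+1%:R^-1.
have e_0 n : 0 < e_ n by rewrite invr_gt0 ltr0n.
have e_small (d : R) : 0 < d -> exists N, forall n, (N <= n)%N -> e_ n <= d.
  move=> d0; have [N _ hN] := near_infty_natSinv_lt (PosNum d0).
  by exists N => n Nn; apply: ltW; exact: hN.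
have /choice [A hA] n := step _ (e_0 n).
have /choice [A' hAA] := hA.
pose v y := daniell D (fun g => U g y) f.
have loc y : D y -> exists2 s, 0 < s & sq y s `<=` D /\ forall d, 0 < d ->
    exists N, forall n z, (N <= n)%N -> sq y s z -> A n z + A' n z <= d.
  move=> Dy; have [C [s [C0 s0 sD hC]]] := harnack openD connD Dx Dy.
  exists s => //; split => // d d0.
  have [|N hN] := e_small (d / (C + 1)); first by rewrite divr_gt0 //; lra.
  exists N => n z Nn hz; have [_ hw hx hy] := hAA n.
  have := hC _ hw (fun z Dz => let: And3 h _ _ := hy _ Dz in h) _ hz.
  have : C * (A n x + A' n x) <= C * (d / (C + 1)).
    by apply: ler_wpM2l => //; apply: (le_trans hx); exact: hN.
  have : C * (d / (C + 1)) <= d.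
    by rewrite mulrA ler_pdivrMr; [rewrite mulrC ler_pM2l //|]; lra.
  lra.
have squeeze (a b : R) (X : \bar R) : (a%:E <= X <= b%:E)%E ->
  exists2 t : R, X = t%:E & a <= t <= b.
  by case: X => [t| |] h; [exists t|case/andP: h|case/andP: h].
(* Any one bracket makes the upper integral finite, so [fine] in [daniell] returns its true
   value. *)
have vE y : D y -> upper_int D (fun g => U g y) f = (v y)%:E.
  move=> Dy; have [_ _ _ /(_ _ Dy) [_ /squeeze [t ht _] _]] := hAA 0%N.
  by rewrite /v /daniell ht.
split.
  move=> y Dy; exists (v y); split; first exact: vE.
  (* The lower integral is [- t]. For every [n], both [v y] and [- t] lie between [- A' n y] and
     [A n y], an interval of arbitrarily small length. *)
  have [_ _ _ /(_ _ Dy) [_ _ /squeeze [t ht _]]] := hAA 0%N.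
  rewrite /lower_int ht -EFinN; congr EFin.
  apply/eqP; rewrite -subr_eq0 -normr_le0; apply/ler_addgt0Pr => d d0; rewrite add0r.
  have [s s0 [sD hs]] := loc _ Dy; have [N hN] := hs _ d0.
  have := hN N y (leqnn _) (sq_center y s0).
  have [_ _ _ /(_ _ Dy) [_]] := hAA N; rewrite vE // ht !lee_fin => h1 h2 h3.
  by abslra.
(* Since [v] lies between [- A' n] and [A n], its distance to [A n] is at most the gap, which [loc]
   makes locally uniformly small. *)
apply: (@harmonic_locunif _ _ A) => //; first by move=> n; case: (hAA n).
move=> y Dy; have [s s0 [sD hs]] := loc _ Dy; exists s => //; split => // d /hs [N hN].
exists N => n z Nn hz; have := hN n z Nn hz.
have [_ _ _ /(_ _ (sD _ hz)) [_]] := hAA n; rewrite vE; last exact: sD.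
rewrite !lee_fin -/(v z) => h1 _ h2; abslra.
Qed.

End DirichletIntegral.

Unset Implicit Arguments.

Theorem mainTheorem20 (R : realType) (D : set (R * R))
  (hopen : open D) (hconn : connected D)
  (hbdd : exists M : R, forall x, D x -> `|x.1| <= M /\ `|x.2| <= M)
  (U : (R * R -> R) -> (R * R -> R))
  (hU : forall g, Cbd D g -> dirichlet_sol D g (U g))
  (f : R * R -> \bar R) (x : R * R) (hx : D x)
  (hf : integrable_D D (fun g => U g x) f) :
  (forall y, D y -> integrable_D D (fun g => U g y) f) /\
  harmonic_on D (fun y => daniell D (fun g => U g y) f).
Proof. exact: (integrable_transfer hopen hbdd hU hconn hx hf). Qed.
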